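(* Let $\lambda>0$ and let $\bar\zeta=(\bar x,\bar y,\bar z,\bar u,\bar v,\bar w)$ satisfy the stationarity system with parameter $\lambda$. Suppose that the lower-level problem is convex at $\bar x$ (i.e. $f(\bar x,\cdot)$ and $g_j(\bar x,\cdot)$, $j=1,\dots,q$, are convex), and that: (a) $K$ is uniformly compact near $\bar x$ (there is a neighborhood $U$ of $\bar x$ such that the closure of $\bigcup_{x\in U}K(x)$ is compact) and $K(\bar x)\neq\emptyset$; (b) for every $z\in S(\bar x)$ the family $\{\nabla_2g_j(\bar x,z): g_j(\bar x,z)=0\}$ is linearly independent (LLICQ); (c) for every $d=(d^1,d^2)\in C^\lambda(\bar x,\bar y)$: the strict complementarity condition LSCC holds at $(\bar x,z,w_z)$ for all $z\in S_1(\bar x;d^1)$, and the submanifold property LSMP and the second order condition LSOSC hold at $(\bar x,d^1)$. Suppose moreover that for every $d=(d^1,d^2)\in C^\lambda(\bar x,\bar y)\setminus\{0\}$ there exist a natural number $k$, points $z^t\in S_1(\bar x;d^1)$ with $\Lambda(\bar x,z^t)=\{w^t\}$ and real numbers $\kappa_t$ for $t=1,\dots,k$, with $\kappa_\circ:=\sum_{t=1}^k\kappa_t$, and multipliers $u$, $v$ such that $$\nabla_1\bar{\mathcal{L}}^\lambda_{\kappa_\circ}(\bar x,\bar y,u,v)-\lambda\sum_{t=1}^k\kappa_t\nabla_1\ell(\bar x,z^t,w^t)=0,\qquad \nabla_2\bar{\mathcal{L}}^\lambda_{\kappa_\circ}(\bar x,\bar y,u,v)=0,$$ $$\kappa_\circ+\sum_{i\in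 I^1(d)}u_i+\sum_{j\in I^2(d)}v_j=1,\qquad \kappa_\circ\ge0,\quad u_i\ge0\ \text{for } i\in I^1(d),\quad v_j\ge0\ \text{for } j\in I^2(d),$$ and $$d^\top\nabla^2\bar{\mathcal{L}}^\lambda_{\kappa_\circ}(\bar x,\bar y,u,v)\,d>\lambda\sum_{t=1}^k\kappa_t\,\xi_{d^1}(\bar x,z^t).$$ Then $(\bar x,\bar y)$ is a strict local optimal solution of $$\min_{x,y}\ F(x,y)+\lambda\big(f(x,y)-\varphi(x)\big)\quad\text{s.t.}\quad G(x,y)\le0,\ g(x,y)\le0.$$
   Context: The functions $F,f:\mathbb{R}^n\times\mathbb{R}^m\to\mathbb{R}$, $G:\mathbb{R}^n\times\mathbb{R}^m\to\mathbb{R}^p$ and $g:\mathbb{R}^n\times\mathbb{R}^m\to\mathbb{R}^q$ are twice continuously differentiable. $\nabla_1,\nabla_2$ denote gradients with respect to the first (in $\mathbb{R}^n$) and second (in $\mathbb{R}^m$) variable; $\nabla,\nabla^2$ without index denote the gradient and Hessian with respect to both; $\nabla_2^2$ is the Hessian with respect to the second variable. $K(x):=\{z\in\mathbb{R}^m\mid g(x,z)\le0\}$; $S(x):=\operatorname{argmin}_z\{f(x,z)\mid z\in K(x)\}$ is assumed nonempty for all $x\in\mathbb{R}^n$; $\varphi(x):=\min_z\{f(x,z)\mid z\in K(x)\}$. $\ell(x,z,w):=f(x,z)+w^\top g(x,z)$ and $\Lambda(x,z):=\{w\in\mathbb{R}^q\mid\nabla_2\ell(x,z,w)=0,\ w\ge0,\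 g(x,z)\le0,\ w^\top g(x,z)=0\}$. Under (b), $\Lambda(\bar x,z)$ is a singleton $\{w_z\}$ for each $z\in S(\bar x)$. Stationarity system with parameter $\lambda$ (for $(x,y,z,u,v,w)\in\mathbb{R}^n\times\mathbb{R}^m\times\mathbb{R}^m\times\mathbb{R}^p\times\mathbb{R}^q\times\mathbb{R}^q$): $\nabla_1F(x,y)+\sum_iu_i\nabla_1G_i(x,y)+\sum_jv_j\nabla_1g_j(x,y)+\lambda\nabla_1f(x,y)-\lambda\nabla_1\ell(x,z,w)=0$; $\nabla_2F(x,y)+\sum_iu_i\nabla_2G_i(x,y)+\sum_jv_j\nabla_2g_j(x,y)+\lambda\nabla_2f(x,y)=0$; $\nabla_2\ell(x,z,w)=0$; $u\ge0$, $G(x,y)\le0$, $u^\top G(x,y)=0$; $v\ge0$, $g(x,y)\le0$, $v^\top g(x,y)=0$; $w\ge0$, $g(x,z)\le0$, $w^\top g(x,z)=0$. Index sets: $I^1:=\{i\mid G_i(\bar x,\bar y)=0\}$, $I^2:=\{j\mid g_j(\bar x,\bar y)=0\}$, $I^g(\bar x,z):=\{j\mid g_j(\bar x,z)=0\}$; $\nu^1:=\{i\in I^1\mid\bar u_i>0\}$, $\theta^1:=\{i\in I^1\mid\bar u_i=0\}$, $\nu^2:=\{j\in I^2\mid\bar v_j>0\}$, $\theta^2:=\{j\in I^2\mid\bar v_j=0\}$; for $d\in\mathbb{R}^{n+m}$, $I^1(d):=\{i\in I^1\mid\nabla G_i(\bar x,\bar y)^\top d=0\}$, $I^2(d):=\{j\in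 I^2\mid\nabla g_j(\bar x,\bar y)^\top d=0\}$. $C^\lambda(\bar x,\bar y)$ is the set of $d=(d^1,d^2)\in\mathbb{R}^n\times\mathbb{R}^m$ such that $\nabla G_i(\bar x,\bar y)^\top d=0$ for $i\in\nu^1$, $\nabla G_i(\bar x,\bar y)^\top d\le0$ for $i\in\theta^1$, $\nabla g_j(\bar x,\bar y)^\top d=0$ for $j\in\nu^2$, $\nabla g_j(\bar x,\bar y)^\top d\le0$ for $j\in\theta^2$, and $\nabla F(\bar x,\bar y)^\top d+\lambda\nabla f(\bar x,\bar y)^\top d-\lambda\nabla_1\ell(\bar x,z,w_z)^\top d^1\le0$ for all $z\in S(\bar x)$. For $\delta\in\mathbb{R}^n$: $S_1(\bar x;\delta):=\operatorname{argmin}_{z\in S(\bar x)}\nabla_1\ell(\bar x,z,w_z)^\top\delta$. LSCC at $(\bar x,z,w)$: $\{j\mid w_j=g_j(\bar x,z)=0\}=\emptyset$. LSMP at $(\bar x,\delta)$: for every $z_0\in S_1(\bar x;\delta)$, the restriction of $S(\bar x)$ to a neighborhood of $z_0$ is a smooth submanifold of $\{z\mid g_j(\bar x,z)=0\text{ for all }j\in I^g(\bar x,z_0)\}$. LSOSC at $(\bar x,\delta)$: $e^\top\nabla_2^2\ell(\bar x,z,w_z)e>0$ for all $z\in S_1(\bar x;\delta)$ and all $e\in[T_\circ(z)]^\perp\setminus\{0\}$ with $\nabla_2g_j(\bar x,z)^\top e=0$ for all $j\in I^g(\bar x,z)$, where $T_\circ(z)$ is the tangent space of $S(\bar x)$ at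 $z$. For $\delta\in\mathbb{R}^n$ and $z\in S_1(\bar x;\delta)$: $\xi_\delta(\bar x,z):=\min_{e\in\mathcal{Z}_\delta(\bar x,z)}(\delta^\top,e^\top)\nabla^2\ell(\bar x,z,w_z)(\delta^\top,e^\top)^\top$, where $\nabla^2\ell$ is the Hessian with respect to the first two variables and $\mathcal{Z}_\delta(\bar x,z):=\{e\in\mathbb{R}^m\mid\nabla_1g_j(\bar x,z)^\top\delta+\nabla_2g_j(\bar x,z)^\top e=0,\ j\in I^g(\bar x,z)\}$. For given $d$: $\bar{\mathcal{L}}^\lambda_\kappa(x,y,u,v):=\kappa\,(F(x,y)+\lambda f(x,y))+\sum_{i\in I^1(d)}u_iG_i(x,y)+\sum_{j\in I^2(d)}v_jg_j(x,y)$; its derivatives $\nabla_1,\nabla_2,\nabla^2$ are with respect to $x$, $y$, and $(x,y)$ respectively. *)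

(* Defs.v *)
From HB Require Import structures.
From mathcomp Require Export all_boot all_order all_algebra.
From mathcomp Require Export all_classical all_reals all_analysis.
Export Order.TTheory GRing.Theory Num.Theory.
Export numFieldNormedType.Exports.

Set Implicit Arguments.
Unset Strict Implicit.
Unset Printing Implicit Defensive.

Local Open Scope classical_set_scope.
Local Open Scope ring_scope.

(* Vectors of R^n are row vectors 'rV[R]_n, and vector-valued constraints are
   families of component functions.  A function of two vector variables is
   curried; [joint f] is the same function on R^(n+m), whose gradient and
   Hessian are those "with respect to both variables". *)

Definition joint (R : realType) (n m : nat) (f : 'rV[R]_n -> 'rV[R]_m -> R)
  : 'rV[R]_(n + m) -> R := fun s => f (lsubmx s) (rsubmx s).

Definition dot (R : realType) (n : nat) (a b : 'rV[R]_n) : R :=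
  (a *m b^T) 0 0.

Definition quad (R : realType) (n : nat) (H : 'M[R]_n) (d : 'rV[R]_n) : R :=
  (d *m H *m d^T) 0 0.

Definition grad (R : realType) (n : nat) (f : 'rV[R]_n -> R) (x : 'rV[R]_n)
  : 'rV[R]_n := \row_i 'D_(delta_mx 0 i) f x.

Definition hess (R : realType) (n : nat) (f : 'rV[R]_n -> R) (x : 'rV[R]_n)
  : 'M[R]_n :=
  \matrix_(i, j) 'D_(delta_mx 0 i) (fun x' => 'D_(delta_mx 0 j) f x') x.

Definition grad1 (R : realType) (n m : nat) (f : 'rV[R]_n -> 'rV[R]_m -> R)
  (x : 'rV[R]_n) (y : 'rV[R]_m) : 'rV[R]_n := grad (fun x' => f x' y) x.

Definition grad2 (R : realType) (n m : nat) (f : 'rV[R]_n -> 'rV[R]_m -> R)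
  (x : 'rV[R]_n) (y : 'rV[R]_m) : 'rV[R]_m := grad (f x) y.

Definition gradient (R : realType) (n m : nat) (f : 'rV[R]_n -> 'rV[R]_m -> R)
  (x : 'rV[R]_n) (y : 'rV[R]_m) : 'rV[R]_(n + m) :=
  grad (joint f) (row_mx x y).

Definition hessian (R : realType) (n m : nat) (f : 'rV[R]_n -> 'rV[R]_m -> R)
  (x : 'rV[R]_n) (y : 'rV[R]_m) : 'M[R]_(n + m) :=
  hess (joint f) (row_mx x y).

Definition hess2 (R : realType) (n m : nat) (f : 'rV[R]_n -> 'rV[R]_m -> R)
  (x : 'rV[R]_n) (y : 'rV[R]_m) : 'M[R]_m := hess (f x) y.

Definition C1_on (R : realType) (V W : normedModType R) (A : set V)
  (f : V -> W) : Prop :=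
  forall x, A x -> differentiable f x /\
    forall v : V, {for x, continuous (fun x' => 'D_v f x')}.

Definition C2 (R : realType) (V W : normedModType R) (f : V -> W) : Prop :=
  C1_on setT f /\ forall v : V, C1_on setT (fun x => 'D_v f x).

Definition argmin (R : realType) (T : Type) (A : set T) (h : T -> R) : set T :=
  [set z | A z /\ forall z', A z' -> h z <= h z'].

(* Total version of min_A h: it is the minimum whenever the latter is attained
   (lemma [minvalE]). *)
Definition minval (R : realType) (T : Type) (A : set T) (h : T -> R) : R :=
  inf [set h z | z in A].

Lemma minvalE (R : realType) (T : Type) (A : set T) (h : T -> R) (z : T) :
  argmin A h z -> minval A h = h z.
Proof.
move=> [Az zmin]; apply/eqP; rewrite eq_le; apply/andP; split.
  by apply: ge_inf; [exists (h z) => _ [z' Az' <-]; exact: zmin|exists z].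
by apply: lb_le_inf; [exists (h z), z|move=> _ [z' Az' <-]; exact: zmin].
Qed.

Definition strict_local_min (R : realType) (T : topologicalType) (D : set T)
  (h : T -> R) (s0 : T) : Prop :=
  D s0 /\ \forall s \near s0, D s -> s <> s0 -> h s0 < h s.

Definition complementary (R : realType) (p : nat) (u : 'rV[R]_p)
  (a : 'I_p -> R) : Prop :=
  [/\ forall i, 0 <= u 0 i, forall i, a i <= 0 & \sum_i u 0 i * a i = 0].

(* Embedded C^1 submanifold of R^m (without boundary) of codimension c: locally
   the zero set of c functions of class C^1 with linearly independent
   gradients.  "Smooth" is read as C^1: the ambient level sets of the C^2
   functions g_j are not smoother than C^2, and C^1 is the weakest hypothesis. *)
Definition C1_submanifold (R : realType) (m : nat) (N : set 'rV[R]_m) : Prop :=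
  exists c : nat, forall z, N z -> exists (V : set 'rV[R]_m)
      (h : 'I_c -> 'rV[R]_m -> R),
    [/\ open V, V z, forall i, C1_on V (h i),
        N `&` V = [set z' | V z' /\ forall i, h i z' = 0]
      & forall z', V z' -> free [seq grad (h i) z' | i : 'I_c]].

(* Tangent space of N at z: velocities at z of C^1 curves lying in N. *)
Definition tangent_space (R : realType) (m : nat) (N : set 'rV[R]_m)
  (z : 'rV[R]_m) : set 'rV[R]_m :=
  [set e | exists gamma : R -> 'rV[R]_m,
    [/\ C1_on setT gamma, gamma 0 = z, \forall t \near (0 : R), N (gamma t)
      & 'D_1 gamma 0 = e]].

Definition orthogonal (R : realType) (m : nat) (T : set 'rV[R]_m)
  : set 'rV[R]_m := [set e | forall t, T t -> dot e t = 0].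

Section lower_level.
Context (R : realType) (n m q : nat) (f : 'rV[R]_n -> 'rV[R]_m -> R)
  (g : 'I_q -> 'rV[R]_n -> 'rV[R]_m -> R).

Definition K (x : 'rV[R]_n) : set 'rV[R]_m := [set z | forall j, g j x z <= 0].

Definition Sol (x : 'rV[R]_n) : set 'rV[R]_m := argmin (K x) (f x).

Definition phi (x : 'rV[R]_n) : R := minval (K x) (f x).

Definition uniformly_compact (x : 'rV[R]_n) : Prop :=
  exists U, nbhs x U /\ compact (closure (\bigcup_(x' in U) K x')).

Definition active (x : 'rV[R]_n) (z : 'rV[R]_m) : {set 'I_q} :=
  [set j : 'I_q | g j x z == 0]%SET.

Definition LLICQ (x : 'rV[R]_n) (z : 'rV[R]_m) : Prop :=
  free [seq grad2 (g j) x z | j in active x z].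

Definition ell (w : 'rV[R]_q) (x : 'rV[R]_n) (z : 'rV[R]_m) : R :=
  f x z + \sum_j w 0 j * g j x z.

Definition Lambda (x : 'rV[R]_n) (z : 'rV[R]_m) : set 'rV[R]_q :=
  [set w | grad2 (ell w) x z = 0 /\ complementary w (fun j => g j x z)].

(* The multiplier w_z: the element of Lambda x z when this is a singleton
   (lemma [multE]). *)
Definition mult (x : 'rV[R]_n) (z : 'rV[R]_m) : 'rV[R]_q := xget 0 (Lambda x z).

Lemma multE x z w : Lambda x z = [set w] -> mult x z = w.
Proof. by move=> Lw; apply: xget_unique; rewrite Lw //= => w' ->. Qed.

Definition S1 (x delta : 'rV[R]_n) : set 'rV[R]_m :=
  argmin (Sol x) (fun z => dot (grad1 (ell (mult x z)) x z) delta).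

Definition LSCC (x : 'rV[R]_n) (z : 'rV[R]_m) (w : 'rV[R]_q) : Prop :=
  [set j | w 0 j = 0 /\ g j x z = 0] = set0.

(* A submanifold of the active manifold M at z0 is a submanifold of R^m
   contained in M. *)
Definition LSMP (x delta : 'rV[R]_n) : Prop :=
  forall z0, S1 x delta z0 -> exists V,
    [/\ nbhs z0 V, C1_submanifold (Sol x `&` V)
      & Sol x `&` V `<=` [set z | forall j, j \in active x z0 -> g j x z = 0]].

Definition LSOSC (x delta : 'rV[R]_n) : Prop :=
  forall z, S1 x delta z -> forall e, orthogonal (tangent_space (Sol x) z) e ->
    e != 0 -> (forall j, j \in active x z -> dot (grad2 (g j) x z) e = 0) ->
    0 < quad (hess2 (ell (mult x z)) x z) e.

Definition Zset (delta : 'rV[R]_n) (x : 'rV[R]_n) (z : 'rV[R]_m)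
  : set 'rV[R]_m :=
  [set e | forall j, j \in active x z ->
     dot (grad1 (g j) x z) delta + dot (grad2 (g j) x z) e = 0].

Definition xi (delta : 'rV[R]_n) (x : 'rV[R]_n) (z : 'rV[R]_m) : R :=
  minval (Zset delta x z)
    (fun e => quad (hessian (ell (mult x z)) x z) (row_mx delta e)).

End lower_level.

Definition active_dir (R : realType) (n m q : nat)
  (g : 'I_q -> 'rV[R]_n -> 'rV[R]_m -> R) (x : 'rV[R]_n) (y : 'rV[R]_m)
  (d : 'rV[R]_(n + m)) : {set 'I_q} :=
  [set j in active g x y | dot (gradient (g j) x y) d == 0]%SET.

Definition nu (R : realType) (n m q : nat)
  (g : 'I_q -> 'rV[R]_n -> 'rV[R]_m -> R) (x : 'rV[R]_n) (y : 'rV[R]_m)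
  (v : 'rV[R]_q) : {set 'I_q} := [set j in active g x y | 0 < v 0 j]%SET.

Definition theta (R : realType) (n m q : nat)
  (g : 'I_q -> 'rV[R]_n -> 'rV[R]_m -> R) (x : 'rV[R]_n) (y : 'rV[R]_m)
  (v : 'rV[R]_q) : {set 'I_q} := [set j in active g x y | v 0 j == 0]%SET.

Section bilevel.
Context (R : realType) (n m p q : nat) (F f : 'rV[R]_n -> 'rV[R]_m -> R)
  (G : 'I_p -> 'rV[R]_n -> 'rV[R]_m -> R)
  (g : 'I_q -> 'rV[R]_n -> 'rV[R]_m -> R) (lambda : R).

Definition stationary (x : 'rV[R]_n) (y z : 'rV[R]_m) (u : 'rV[R]_p)
    (v w : 'rV[R]_q) : Prop :=
  [/\ grad1 F x y + \sum_i u 0 i *: grad1 (G i) x y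
        + \sum_j v 0 j *: grad1 (g j) x y + lambda *: grad1 f x y
        - lambda *: grad1 (ell f g w) x z = 0
    , grad2 F x y + \sum_i u 0 i *: grad2 (G i) x y
        + \sum_j v 0 j *: grad2 (g j) x y + lambda *: grad2 f x y = 0
    , grad2 (ell f g w) x z = 0
    & [/\ complementary u (fun i => G i x y), complementary v (fun j => g j x y)
        & complementary w (fun j => g j x z)]].

Definition critical_cone (x : 'rV[R]_n) (y : 'rV[R]_m) (u : 'rV[R]_p)
    (v : 'rV[R]_q) : set 'rV[R]_(n + m) :=
  [set d |
    [/\ forall i, i \in nu G x y u -> dot (gradient (G i) x y) d = 0
      , forall i, i \in theta G x y u -> dot (gradient (G i) x y) d <= 0
      , forall j, j \in nu g x y v -> dot (gradient (g j) x y) d = 0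
      , forall j, j \in theta g x y v -> dot (gradient (g j) x y) d <= 0
      & forall z, Sol f g x z ->
          dot (gradient F x y) d + lambda * dot (gradient f x y) d
          - lambda * dot (grad1 (ell f g (mult f g x z)) x z) (lsubmx d) <= 0]].

Definition Lbar (I : {set 'I_p}) (J : {set 'I_q}) (kappa : R) (u : 'rV[R]_p)
    (v : 'rV[R]_q) (x : 'rV[R]_n) (y : 'rV[R]_m) : R :=
  kappa * (F x y + lambda * f x y) + \sum_(i in I) u 0 i * G i x y
  + \sum_(j in J) v 0 j * g j x y.

Definition second_order_condition (x : 'rV[R]_n) (y : 'rV[R]_m)
    (d : 'rV[R]_(n + m)) : Prop :=
  let I := active_dir G x y d in
  let J := active_dir g x y d in
  exists (k : nat) (zt : 'I_k -> 'rV[R]_m) (wt : 'I_k -> 'rV[R]_q)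
    (kappa : 'I_k -> R) (u : 'rV[R]_p) (v : 'rV[R]_q),
    let kappa0 := \sum_t kappa t in
    (forall t, S1 f g x (lsubmx d) (zt t) /\ Lambda f g x (zt t) = [set wt t]) /\
    grad1 (Lbar I J kappa0 u v) x y
      - lambda *: \sum_t kappa t *: grad1 (ell f g (wt t)) x (zt t) = 0 /\
    grad2 (Lbar I J kappa0 u v) x y = 0 /\
    kappa0 + \sum_(i in I) u 0 i + \sum_(j in J) v 0 j = 1 /\
    0 <= kappa0 /\
    (forall i, i \in I -> 0 <= u 0 i) /\
    (forall j, j \in J -> 0 <= v 0 j) /\
    lambda * \sum_t kappa t * xi f g (lsubmx d) x (zt t)
      < quad (hessian (Lbar I J kappa0 u v) x y) d.

Definition feasible : set ('rV[R]_n * 'rV[R]_m) :=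
  [set s | (forall i, G i s.1 s.2 <= 0) /\ (forall j, g j s.1 s.2 <= 0)].

Definition objective (s : 'rV[R]_n * 'rV[R]_m) : R :=
  F s.1 s.2 + lambda * (f s.1 s.2 - phi f g s.1).

End bilevel.

(* Main.v *)
(* Since d = 0 is a critical direction and S1 xb 0 is all of S(xb), LSMP makes
   the compact convex set S(xb) locally a submanifold at each of its points.  At
   a point of S(xb) farthest from the origin this is only possible if S(xb) has no
   other point, so S(xb) = {zb}, and the signs of the individual kappa_t do not
   matter.  Along a ray xb + t d^1, every e in Z_d(xb, zb) yields, by LLICQ and an
   implicit function argument, points z = zb + t e + o(t) with g_j(x, z) = 0 for
   all active j; hence phi(x) <= l(x, z, wb), which bounds phi from above up to
   second order.  Comparing this bound with the second order expansion of the
   Lagrangian excludes, near every direction d, feasible points with objective at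
   most that of (xb, yb); compactness of the unit sphere makes this uniform in d. *)
Require Import Defs.
From mathcomp Require Import ring lra.

Set Implicit Arguments.
Unset Strict Implicit.
Unset Printing Implicit Defensive.

Local Open Scope classical_set_scope.
Local Open Scope ring_scope.

(** * Directional derivatives *)

(** Points approaching [(xb, yb)] along [d] have directions [d'] that only tend to [d], so every
    estimate is made for [d'] near [d] and small [t > 0] together. This shapes the second order
    bounds: their first order terms stay at [d'], since moving them to [d] would cost
    [t * |d' - d|], which [t ^+ 2 * eps] need not absorb. The Lagrangian and the bound on [phi] both
    have such a term, and the multiplier equations make the two cancel exactly. The implicit
    function argument likewise moves a direction by a small amount that is not known to be of order
    [t]; this is harmless because only the lower-level variable moves, and the gradient of [ell] in
    it vanishes at [zb]. Since [phi] enters the objective with the coefficient [- lambda], an upper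
    bound on it, provided by any feasible lower-level point, bounds the objective from below. *)

Lemma is_derive_line (R : realType) (V W : normedModType R) (h : V -> W)
    (p v : V) (t : R) : derivable h (p + t *: v) v ->
  is_derive t 1 (fun t => h (p + t *: v)) ('D_v h (p + t *: v)).
Proof.
move=> dh; rewrite /derivable /derive in dh *.
have E : (fun s : R => s^-1 *: (h (p + (s *: (1 : R) + t) *: v) - h (p + t *: v)))
       = (fun s : R => s^-1 *: (h (s *: v + (p + t *: v)) - h (p + t *: v))).
  apply/funext => s; congr (_ *: (h _ - _)).
  by rewrite [s *: _]mulr1 scalerDl addrCA.
by split; rewrite /derivable /derive /= E.
Qed.

Lemma derive_segment (R : realType) (V : normedModType R) (h : V -> R)
    (p v : V) : (forall t : R, 0 <= t <= 1 -> derivable h (p + t *: v) v) ->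
  exists2 t : R, 0 < t < 1 & h (p + v) - h p = 'D_v h (p + t *: v).
Proof.
move=> dh.
have dl (t : R) : t \in `[0, 1]%R -> 
    is_derive t 1 (fun t => h (p + t *: v)) ('D_v h (p + t *: v)).
  by rewrite in_itv => t01; exact/is_derive_line/dh.
pose H (t : R) : R := h (p + t *: v).
pose dH (t : R) : R := 'D_v h (p + t *: v).
have dHd (t : R) : t \in `]0, 1[%R -> is_derive t 1 H (dH t).
  by move=> t01; apply: dl; exact: subset_itv_oo_cc.
have cH : {within `[0, 1], continuous H}.
  by apply: derivable_within_continuous => x /dl [].
have [c c01] := @MVT R H dH 0 1 ltr01 dHd cH.
rewrite /H scale1r scale0r addr0 subr0 mulr1 => ->.
by exists c => //; move: c01; rewrite in_itv.
Qed.

Lemma derive_coord (R : realType) (N : nat) (h : 'rV[R]_N -> R) (y v : 'rV[R]_N) :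
  differentiable h y -> 'D_v h y = \sum_i v 0 i * 'D_(delta_mx 0 i) h y.
Proof.
move=> dh; rewrite deriveE // [in LHS](row_sum_delta v) linear_sum /=.
by apply: eq_bigr => i _; rewrite linearZ /= deriveE.
Qed.

Lemma derive_dot (R : realType) (N : nat) (h : 'rV[R]_N -> R) (y v : 'rV[R]_N) :
  differentiable h y -> 'D_v h y = dot (grad h y) v.
Proof.
move=> dh; rewrite derive_coord // /dot mxE; apply: eq_bigr => i _.
by rewrite !mxE mulrC.
Qed.

Lemma cvg_sum (R : realType) (T I : Type) (r : seq I) (F : set_system T) {FF : Filter F}
    (f : I -> T -> R) (l : I -> R) : (forall i, f i @ F --> l i) ->
  (fun x => \sum_(i <- r) f i x) @ F --> (\sum_(i <- r) l i : R).
Proof.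
move=> fl; elim: r => [|i r IH].
  by rewrite big_nil; under eq_fun do rewrite big_nil; exact: cvg_cst.
by rewrite big_cons; under eq_fun do rewrite big_cons; apply: cvgD.
Qed.

(** [C1_on] gives continuity of ['D_v h] for each fixed [v] only; expanding the derivative over
    coordinate directions makes it jointly continuous in point and direction. *)
Lemma C1_derive_cvg (R : realType) (N : nat) (A : set 'rV[R]_N)
    (h : 'rV[R]_N -> R) (s D : 'rV[R]_N) : open A -> A s -> C1_on A h ->
  (fun yv : 'rV[R]_N * 'rV[R]_N => 'D_yv.2 h yv.1 : R) @ (s, D) --> ('D_D h s : R).
Proof.
move=> oA As hC1.
apply: (@cvg_trans _ ((fun yv : 'rV[R]_N * 'rV[R]_N =>
  \sum_i yv.2 0 i * 'D_(delta_mx 0 i) h yv.1 : R) @ (s, D))).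
  apply: near_eq_cvg.
  have : \forall yv \near (s, D), A yv.1.
    by apply: (@cvg_fst _ _ (nbhs s) (nbhs D)); exact: open_nbhs_nbhs.
  by apply: filterS => yv /hC1[d _]; rewrite derive_coord.
rewrite derive_coord; last by have [] := hC1 _ As.
apply: (@cvg_sum R _ _ _ (nbhs (s, D)) _ (fun i (yv : 'rV[R]_N * 'rV[R]_N) =>
  yv.2 0 i * 'D_(delta_mx 0 i) h yv.1)) => i; apply: cvgM.
  apply: (@cvg_comp _ _ _ snd (fun v : 'rV[R]_N => v 0 i) _ (nbhs D)); first exact: cvg_snd.
  exact: coord_continuous.
apply: (@cvg_comp _ _ _ fst (fun y => 'D_(delta_mx 0 i) h y) _ (nbhs s)); first exact: cvg_fst.
by have [_] := hC1 _ As; apply.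
Qed.

Lemma quadE (R : realType) (N : nat) (H : 'M[R]_N) (d : 'rV[R]_N) :
  quad H d = \sum_j (\sum_i d 0 i * H i j) * d 0 j.
Proof. by rewrite /quad mxE; apply: eq_bigr => j _; rewrite !mxE. Qed.

Lemma C2_derive2 (R : realType) (N : nat) (h : 'rV[R]_N -> R) (y v : 'rV[R]_N) :
  C2 h -> 'D_v (fun x => 'D_v h x) y = quad (hess h y) v.
Proof.
move=> [h1 h2].
have -> : (fun x => 'D_v h x) = \sum_i v 0 i *: (fun x => 'D_(delta_mx 0 i) h x).
  apply/funext => x; rewrite derive_coord ?fct_sumE //; last by have [] := h1 x I.
have d2 i : differentiable (fun x => 'D_(delta_mx 0 i) h x) y by have [] := h2 (delta_mx 0 i) y I.
rewrite derive_sum; last by move=> i; apply: derivableZ; exact: diff_derivable.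
rewrite quadE; apply: eq_bigr => j _.
rewrite deriveZ; last exact: diff_derivable.
rewrite derive_coord // [LHS]mulrC; congr (_ * _).
by apply: eq_bigr => i _; rewrite !mxE.
Qed.

Lemma C2_quad_cvg (R : realType) (N : nat) (h : 'rV[R]_N -> R) (s D : 'rV[R]_N) :
  C2 h -> (fun yv : 'rV[R]_N * 'rV[R]_N => quad (hess h yv.1) yv.2 : R) @ (s, D) -->
  (quad (hess h s) D : R).
Proof.
move=> [h1 h2].
set Q := fun yv => _; apply: (eq_ind_r (fun l : R => Q @ (s, D) --> l) _ (quadE (hess h s) D)).
rewrite {}/Q.
have -> : (fun yv : 'rV[R]_N * 'rV[R]_N => quad (hess h yv.1) yv.2) = (fun yv =>
    \sum_j (\sum_i yv.2 0 i * hess h yv.1 i j) * yv.2 0 j).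
  by apply/funext => yv; rewrite quadE.
have cv i : (fun yv : 'rV[R]_N * 'rV[R]_N => yv.2 0 i) @ (s, D) --> D 0 i.
  apply: (@cvg_comp _ _ _ snd (fun v : 'rV[R]_N => v 0 i) _ (nbhs D)); first exact: cvg_snd.
  exact: coord_continuous.
have ch i j : (fun yv : 'rV[R]_N * 'rV[R]_N => hess h yv.1 i j) @ (s, D) --> hess h s i j.
  have [_ /(_ (delta_mx 0 i)) C] := h2 (delta_mx 0 j) s I.
  have E : 'D_(delta_mx 0 i) (fun x => 'D_(delta_mx 0 j) h x) = (fun y => hess h y i j).
    by apply/funext => y; rewrite mxE.
  rewrite {}E in C.
  by apply: (@cvg_comp _ _ _ fst (fun y => hess h y i j) _ (nbhs s)); first exact: cvg_fst.
apply: (@cvg_sum R _ _ _ (nbhs (s, D)) _ (fun j (yv : 'rV[R]_N * 'rV[R]_N) =>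
  (\sum_i yv.2 0 i * hess h yv.1 i j) * yv.2 0 j)) => j.
apply: cvgM; last exact: cv.
apply: (@cvg_sum R _ _ _ (nbhs (s, D)) _ (fun i (yv : 'rV[R]_N * 'rV[R]_N) =>
  yv.2 0 i * hess h yv.1 i j)) => i.
by apply: cvgM; [exact: cv|exact: ch].
Qed.

(** * Expansions along rays and an implicit function lemma *)

Lemma rV_norm_leP (R : realType) (N : nat) (v : 'rV[R]_N) (r : R) :
  0 <= r -> reflect (forall k, `|v 0 k| <= r) (`|v| <= r).
Proof.
move=> r0; rewrite [`|v|]mx_normrE; apply: (iffP (bigmax_leP _ _ _ _)) => [[_ H] k|H].
  exact: (H (0, k)).
by split=> // -[i k] _ /=; rewrite ord1.
Qed.

Lemma contraction_fixpoint (R : realType) (N : nat) (T : 'rV[R]_N -> 'rV[R]_N)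
    (r q : R) : 0 <= r -> 0 <= q < 1 -> (forall a, `|a| <= r -> `|T a| <= r) ->
  (forall a b, `|a| <= r -> `|b| <= r -> `|T a - T b| <= q * `|a - b|) ->
  exists2 a, `|a| <= r & T a = a.
Proof.
move=> r0 /andP[q0 q1] TT Tq; pose U : set 'rV[R]_N := [set a | `|a| <= r].
(* A minimizer of |T a - a| over the compact ball U is a fixed point. *)
have U0 : U !=set0 by exists 0; rewrite /U /= normr0.
have cU : compact U.
  apply: bounded_closed_compact.
    by exists r; split; [exact: num_real|move=> x rx a /= /le_trans; apply; exact: ltW].
  have -> : U = (fun a => `|a|) @^-1` [set x | x <= r] by [].
  by apply: closed_comp => [a _|]; [exact: norm_continuous|exact: closed_le].
have cf : {within U, continuous (fun a : 'rV[R]_N => `|T a - a|)}.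
  apply/subspace_continuousP => x Ux; apply/cvgrPdist_le => e e0.
  rewrite near_withinE; near=> y => Uy.
  apply: le_trans (ler_dist_dist _ _) _.
  have -> : T x - x - (T y - y) = (T x - T y) - (x - y).
    by rewrite !opprB addrACA [in RHS]addrACA; congr (_ + _); rewrite addrC.
  apply: le_trans (ler_normB _ _) _.
  have dxy : `|x - y| <= e / 2.
    by near: y; apply: cvgr_dist_le; [exact: cvg_id|exact: divr_gt0].
  have := Tq x y Ux Uy; have : q * `|x - y| <= `|x - y| by rewrite ler_piMl // ltW.
  lra.
have [a /set_mem Ua amin] := compact_EVT_min U0 cU cf.
exists a => //; apply/eqP; rewrite -subr_eq0 -normr_le0 leNgt; apply/negP => d0.
have := amin (T a) (mem_set (TT a Ua)); apply/negP; rewrite -ltNge.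
apply: le_lt_trans (Tq _ _ (TT _ Ua) Ua) _.
by rewrite gtr_pMl.
Unshelve. all: end_near. Qed.

(** Turns a property near [(s, D)] into one along rays. Uniformity over [|w| <= C] makes it
    available at once at all intermediate points of the mean value theorem and for all corrected
    directions. *)
Lemma near_ray (R : realType) (N : nat) (s D : 'rV[R]_N) (C : R)
    (P : set ('rV[R]_N * 'rV[R]_N)) : nbhs (s, D) P ->
  \forall D' \near D & t \near (0 : R)^'+,
    [/\ `|D'| <= `|D| + 1, 0 < t & forall w, `|w| <= C -> P (s + t *: w, D')].
Proof.
case=> -[/= A1 A2] [/nbhs_ballP[r1 /= r1_0 A1s] /nbhs_ballP[r2 /= r2_0 A2s]] AP.
exists ([set D' | A2 D' /\ `|D'| <= `|D| + 1], [set t | 0 < t < r1 / (`|C| + 1)]).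
  split=> /=.
    apply: filterI; first exact/nbhs_ballP/(ex_intro2 _ _ r2).
    apply/nbhs_ballP; exists 1 => //= D'; rewrite -ball_normE /= => dD.
    by rewrite -[D'](subKr D); apply: le_trans (ler_normB _ _) _; rewrite lerD2l ltW.
  near=> t; apply/andP; split => //=.
  near: t; apply: nbhs_right_lt; apply: divr_gt0 => //.
move=> [D' t] /= [[A2D' D'1] /andP[t0 tr]]; split => // w wC.
apply: (AP (_, _)); split => //=; apply: A1s; rewrite -ball_normE /=.
rewrite opprD addNKr normrN normrZ gtr0_norm //.
have C0 := normr_ge0 C; move: tr; rewrite ltr_pdivlMr; last lra.
apply: le_lt_trans; rewrite ler_pM2l //.
by have := ler_norm C; lra.
Unshelve. all: end_near. Qed.

(** By the mean value theorem the increment is [t] times the derivative along [D'] at an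
    intermediate point, close to ['D_D h s] by joint continuity. An error [t * e] is allowed, so
    [D'] may be replaced by [D]. *)
Lemma C1_ray (R : realType) (N : nat) (h : 'rV[R]_N -> R) (s D : 'rV[R]_N)
    (e : R) : C1_on setT h -> 0 < e ->
  \forall D' \near D & t \near (0 : R)^'+,
    `|h (s + t *: D') - h s - t * 'D_D h s| <= t * e.
Proof.
move=> h1 e0; have cv := C1_derive_cvg (D:=D) openT (I : setT s) h1.
have nM : \forall yv \near (s, D), `|'D_D h s - 'D_yv.2 h yv.1| <= e.
  by move/cvgrPdist_le: cv; apply.
have nr := near_ray (`|D| + 1) nM.
apply: filterS nr => -[D' t] /= [D'1 t0 H].
have [a /andP[a0 a1] E] : exists2 a : R, 0 < a < 1 &
    h (s + t *: D') - h s = t * 'D_D' h (s + t *: (a *: D')).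
  have [a _|a a01] := @derive_segment R _ h s (t *: D').
    by apply: diff_derivable; have [] := h1 (s + a *: (t *: D')) I.
  rewrite deriveE; last by have [] := h1 (s + a *: (t *: D')) I.
  rewrite linearZ /= -deriveE; last by have [] := h1 (s + a *: (t *: D')) I.
  by move=> ->; exists a => //; rewrite scalerA mulrC -scalerA.
rewrite E -mulrBr normrM gtr0_norm // ler_pM2l // distrC; apply: H.
by rewrite normrZ gtr0_norm //; apply: le_trans D'1; rewrite ler_piMl // ltW.
Qed.

Lemma taylor2_segment (R : realType) (N : nat) (h : 'rV[R]_N -> R) (p v : 'rV[R]_N) :
  C2 h -> exists2 a : R, 0 < a < 1 &
    h (p + v) = h p + 'D_v h p + quad (hess h (p + a *: v)) v / 2.
Proof.
move=> h2; have [h1 h1'] := h2.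
pose H (a : R) : R := h (p + a *: v).
pose H1 (a : R) : R := 'D_v h (p + a *: v).
pose H2 (a : R) : R := quad (hess h (p + a *: v)) v.
have dH (a : R) : is_derive a 1 H (H1 a).
  by apply: is_derive_line; apply: diff_derivable; have [] := h1 (p + a *: v) I.
have dH1 (a : R) : is_derive a 1 H1 (H2 a).
  have -> : H2 a = 'D_v ('D_v h) (p + a *: v) by exact/esym/C2_derive2.
  apply: (@is_derive_line _ _ _ ('D_v h)).
  by apply: diff_derivable; have [] := h1' v (p + a *: v) I.
(* With this [c], [psi] takes the same value at 0 and 1. An interior zero of its derivative then
   gives [H2 a = 2 * c], the Lagrange form of the remainder. *)
pose c := H 1 - H 0 - H1 0.
pose psi (a : R) : R := H a + (1 - a) * H1 a + c * (1 - a) ^+ 2.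
have dpsi (a : R) : is_derive a 1 psi ((1 - a) * (H2 a - 2 * c)).
  rewrite /psi; apply: is_derive_eq.
  rewrite /= /GRing.scale /=; ring.
have cpsi : {within `[0, 1], continuous psi}.
  by apply: derivable_within_continuous => x _; have [] := dpsi x.
have [a a01] := @MVT R psi _ 0 1 ltr01 (fun a _ => dpsi a) cpsi.
have -> : psi 1 - psi 0 = 0 by rewrite /psi /c; ring.
move: a01; rewrite in_itv /= => /andP[a0 a1] /esym/eqP.
rewrite subr0 mulr1 mulf_eq0 subr_eq0 gt_eqF //= => /eqP E.
exists a; first by rewrite a0 a1.
have {}E : H2 a = 2 * c by apply/eqP; rewrite -subr_eq0; apply/eqP.
by rewrite -/(H2 a) E /c /H /H1 scale1r scale0r addr0; field.
Qed.

Lemma quadZ (R : realType) (N : nat) (H : 'M[R]_N) (t : R) (d : 'rV[R]_N) :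
  quad H (t *: d) = t ^+ 2 * quad H d.
Proof. by rewrite /quad -!scalemxAl linearZ /= -scalemxAr !mxE mulrA. Qed.

(** The Taylor remainder is evaluated close to [(s, D)], where the Hessian form is jointly
    continuous: the quadratic term can be moved to [D], while the linear one stays at [D']. *)
Lemma C2_ray (R : realType) (N : nat) (h : 'rV[R]_N -> R) (s D : 'rV[R]_N)
    (e : R) : C2 h -> 0 < e ->
  \forall D' \near D & t \near (0 : R)^'+,
    `|h (s + t *: D') - h s - t * 'D_D' h s - t ^+ 2 / 2 * quad (hess h s) D|
      <= t ^+ 2 * e.
Proof.
move=> h2 e0; have [h1 _] := h2; have cv := @C2_quad_cvg _ _ _ s D h2.
have nM : \forall yv \near (s, D),
    `|quad (hess h s) D - quad (hess h yv.1) yv.2| <= e.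
  by move/cvgrPdist_le: cv; apply.
have nr := near_ray (`|D| + 1) nM.
apply: filterS nr => -[D' t] /= [D'1 t0 H].
have [a /andP[a0 a1] E] := @taylor2_segment R N h s (t *: D') h2.
have dE : 'D_(t *: D') h s = t * 'D_D' h s.
  have d := (h1 s I).1.
  by rewrite deriveE // linearZ /= -deriveE.
have aE : a *: (t *: D') = t *: (a *: D') by rewrite !scalerA mulrC.
rewrite {}aE {}dE quadZ in E; rewrite {}E.
have -> (x y z w : R) : x + t * y + t ^+ 2 * z / 2 - x - t * y - t ^+ 2 / 2 * w =
   t ^+ 2 * ((z - w) / 2) by field.
rewrite normrM ger0_norm ?sqr_ge0 // ler_pM2l ?exprn_gt0 //.
rewrite normrM [`|2^-1|]ger0_norm //.
apply: (@le_trans _ _ (e / 2)); last by lra.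
rewrite ler_pM2r // distrC; apply: H.
by rewrite normrZ gtr0_norm //; apply: le_trans D'1; rewrite ler_piMl // ltW.
Qed.

(** [D] is tangent to the zero set, and each row of [B] is a direction that changes a single [h i]
    to first order. A small combination of these rows corrects [D'] so that the ray point lies
    exactly on the zero set, with a bound [e] uniform in [D'] and [t]. *)
Lemma implicit_ray (R : realType) (N c : nat) (A : set 'rV[R]_N)
    (h : 'I_c -> 'rV[R]_N -> R) (s D : 'rV[R]_N) (B : 'M[R]_(c, N)) (e : R) :
    open A -> A s -> (forall i, C1_on A (h i)) -> (forall i, h i s = 0) ->
    (forall i, 'D_D (h i) s = 0) ->
    (forall i k, 'D_(row k B) (h i) s = (i == k)%:R) -> 0 < e ->
  \forall D' \near D & t \near (0 : R)^'+, exists a : 'rV[R]_c,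
    [/\ `|a| <= e, A (s + t *: (D' + a *m B))
      & forall i, h i (s + t *: (D' + a *m B)) = 0].
Proof.
move=> oA As h1 hs hD hB e0.
pose b : R := \sum_k `|row k B|.
have normB (a : 'rV[R]_c) : `|a *m B| <= `|a| * b.
  rewrite mulmx_sum_row mulr_sumr; apply: le_trans (ler_norm_sum _ _ _) _.
  apply: ler_sum => k _; rewrite normrZ ler_wpM2r //.
  exact: (rV_norm_leP a (normr_ge0 a) (lexx _)).
(* Bounds each entry of the identity minus the derivative, so that a row sums to at most
   [c * eta <= 1 / 2], the contraction factor; the successor covers [c = 0]. *)
pose eta : R := (2 * (c.+1)%:R)^-1.
have eta0 : 0 < eta by rewrite invr_gt0 mulr_gt0 // ltr0n.
have nA : \forall yv \near (s, D), A yv.1.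
  by apply: (@cvg_fst _ _ (nbhs s) (nbhs D)); exact: open_nbhs_nbhs.
have nD : \forall yv \near (s, D), forall i : 'I_c, `|'D_yv.2 (h i) yv.1| <= e / 2.
  apply: (@filter_forall _ _ (fun i (yv : 'rV[R]_N * 'rV[R]_N) =>
    `|'D_yv.2 (h i) yv.1| <= e / 2) _ (nbhs_filter (s, D))) => i.
  have := C1_derive_cvg (D := D) oA As (h1 i).
  move/cvgrPdist_le => /(_ (e / 2)); rewrite hD divr_gt0 // => /(_ isT).
  by apply: filterS => yv; rewrite sub0r normrN.
have nB : \forall yv \near (s, D), forall i k : 'I_c,
    `|(i == k)%:R - 'D_(row k B) (h i) yv.1| <= eta.
  apply: (@filter_forall _ _ (fun i (yv : 'rV[R]_N * 'rV[R]_N) =>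
    forall k : 'I_c, `|(i == k)%:R - 'D_(row k B) (h i) yv.1| <= eta) _ (nbhs_filter (s, D))) => i.
  apply: (@filter_forall _ _ (fun k (yv : 'rV[R]_N * 'rV[R]_N) =>
    `|(i == k)%:R - 'D_(row k B) (h i) yv.1| <= eta) _ (nbhs_filter (s, D))) => k.
  have [_ /(_ (row k B)) /cvgrPdist_le /(_ eta eta0)] := h1 i s As.
  rewrite hB => nk.
  by apply: (@cvg_fst _ _ (nbhs s) (nbhs D) _
    [set y | `|(i == k)%:R - 'D_(row k B) (h i) y| <= eta]).
(* This radius bounds [|D' + a *m B|] for all [|a| <= e], so the estimates hold on every segment
   used below. *)
have nr := near_ray (`|D| + 1 + e * b) (@filterI _ _ (nbhs_filter (s, D)) _ _ nA
  (@filterI _ _ (nbhs_filter (s, D)) _ _ nD nB)).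
apply: filterS nr => -[D' t] /= [D'1 t0 H].
have b0 : 0 <= b by apply: sumr_ge0.
(* The map a |-> h (s + t (D' + a B)) / t is C^1-close to the identity, so T, whose
   fixed points are its zeros, is a contraction. *)
pose T (a : 'rV[R]_c) : 'rV[R]_c := a - \row_i (t^-1 * h i (s + t *: (D' + a *m B))).
have nw (a : 'rV[R]_c) : `|a| <= e -> `|D' + a *m B| <= `|D| + 1 + e * b.
  move=> ae; apply: le_trans (ler_normD _ _) (lerD D'1 _).
  by apply: le_trans (normB a) _; rewrite ler_wpM2r.
(* Together with the contraction factor [1 / 2], this makes [T] map the ball of radius [e] into
   itself. *)
have T0 : `|T 0| <= e / 2.
  have e20 : 0 <= e / 2 by rewrite divr_ge0 // ltW.
  apply/rV_norm_leP => // i; rewrite !mxE sub0r normrN mul0mx addr0.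
  have [a /andP[a0 a1] E] : exists2 a : R, 0 < a < 1 &
      h i (s + t *: D') = t * 'D_D' (h i) (s + t *: (a *: D')).
    have nD' (a : R) : 0 <= a <= 1 -> `|a *: D'| <= `|D| + 1 + e * b.
      case/andP=> a0 a1; rewrite normrZ ger0_norm //; apply: le_trans (_ : `|D'| <= _).
        by rewrite ler_piMl.
      by apply: le_trans D'1 _; rewrite lerDl mulr_ge0 // ltW.
    have d (a : R) : 0 <= a <= 1 -> differentiable (h i) (s + a *: (t *: D')).
      by rewrite scalerA mulrC -scalerA => /nD'/H[/(h1 i)[]].
    have [a a01|a a01] := @derive_segment R _ (h i) s (t *: D').
      by apply: diff_derivable; exact: d.
    have a01' : 0 <= a <= 1 by case/andP: a01 => *; rewrite !ltW.
    rewrite hs subr0 => ->; exists a => //.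
    rewrite deriveE; last exact: d.
    by rewrite linearZ /= -deriveE; [rewrite scalerA mulrC -scalerA|exact: d].
  rewrite E mulKf ?gt_eqF //.
  have [] := H (a *: D'); last by move=> _ [].
  rewrite normrZ gtr0_norm //; apply: le_trans (_ : `|D'| <= _).
    by rewrite ler_piMl // ltW.
  by apply: le_trans D'1 _; rewrite lerDl mulr_ge0 // ltW.
have TL (a a' : 'rV[R]_c) : `|a| <= e -> `|a'| <= e ->
    `|T a - T a'| <= 2^-1 * `|a - a'|.
  move=> ae a'e; apply/rV_norm_leP => [|i]; first by rewrite mulr_ge0.
  pose p := s + t *: (D' + a' *m B); pose v := t *: ((a - a') *m B).
  have pv : p + v = s + t *: (D' + a *m B).
    by rewrite /p /v -addrA -scalerDr -addrA -mulmxDl [a' + _]addrC subrK.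
  have inH (r : R) : 0 <= r <= 1 -> `|D' + (a' + r *: (a - a')) *m B| <= `|D| + 1 + e * b.
    case/andP=> r0 r1; apply: nw; rewrite scalerBr addrCA -{1}[a']scale1r -scalerBl.
    apply: le_trans (ler_normD _ _) _; rewrite !normrZ (ger0_norm r0) ger0_norm ?subr_ge0 //.
    apply: le_trans (_ : r * e + (1 - r) * e <= _); last by rewrite -mulrDl addrC subrK mul1r.
    by rewrite lerD // ler_wpM2l // subr_ge0.
  have pr (r : R) : p + r *: v = s + t *: (D' + (a' + r *: (a - a')) *m B).
    by rewrite /p /v scalerA mulrC -scalerA -addrA -scalerDr scalemxAl -addrA -mulmxDl.
  have d (r : R) : 0 <= r <= 1 -> differentiable (h i) (p + r *: v).
    by rewrite pr => /inH/H[/(h1 i)[]].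
  have [r r01|r r01] := @derive_segment R _ (h i) p v.
    by apply: diff_derivable; exact: d.
  have r01' : 0 <= r <= 1 by case/andP: r01 => *; rewrite !ltW.
  have [_ [_ nBr]] := H _ (inH r r01').
  have -> : 'D_v (h i) (p + r *: v) = t * \sum_k (a - a') 0 k * 'D_(row k B) (h i) (p + r *: v).
    have dr := d r r01'.
    rewrite deriveE // linearZ /= mulmx_sum_row linear_sum; congr (_ * _).
    by apply: eq_bigr => k _; rewrite linearZ /= deriveE.
  rewrite pv => E.
  have -> : (T a - T a') 0 i =
      \sum_k (a - a') 0 k * ((i == k)%:R - 'D_(row k B) (h i) (p + r *: v)).
    under [in RHS]eq_bigr do rewrite mulrBr.
    rewrite big_split /= (bigD1 i) //= eqxx mulr1 big1 ?addr0; last first.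
      by move=> k /negPf; rewrite eq_sym => ->; rewrite mulr0.
    rewrite sumrN; set S := \sum_k _.
    have -> : S = t^-1 * (h i (s + t *: (D' + a *m B)) - h i p) by rewrite E mulKf ?gt_eqF.
    by rewrite /T !mxE /p; ring.
  apply: le_trans (ler_norm_sum _ _ _) _.
  apply: (@le_trans _ _ (\sum_(k < c) `|a - a'| * eta)).
    apply: ler_sum => k _; rewrite normrM.
    apply: ler_pM; [exact: normr_ge0|exact: normr_ge0| |by rewrite pr; exact: nBr].
    exact: (rV_norm_leP _ (normr_ge0 _) (lexx _)).
  rewrite sumr_const card_ord -mulrnAr mulrC ler_wpM2r //.
  rewrite /eta invfM -[_ *+ c]mulr_natr -mulrA ler_piMr //.
  by rewrite mulrC ler_pdivrMr ?ltr0n // mul1r ler_nat.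
have TU a : `|a| <= e -> `|T a| <= e.
  move=> ae; have := ler_normD (T a - T 0) (T 0); rewrite subrK => /le_trans; apply.
  have := TL a 0 ae; rewrite normr0 subr0 (ltW e0) => /(_ isT); lra.
have h01 : 0 <= (2^-1 : R) < 1 by apply/andP; split; lra.
have [a ae Ta] := @contraction_fixpoint R c T e 2^-1 (ltW e0) h01 TU TL.
exists a; split=> //; first by have [] := H _ (nw a ae).
move=> i; have /rowP/(_ i) := Ta; rewrite !mxE => /eqP.
rewrite -subr_eq0 addrAC subrr sub0r oppr_eq0 mulf_eq0 invr_eq0 gt_eqF //=.
by move/eqP.
Qed.

(** * Convex sets that are locally submanifolds *)

Lemma near2_diag (R : realType) (T : topologicalType) (D : T) (P : T -> R -> Prop) :
  (\forall D' \near D & t \near (0 : R)^'+, P D' t) ->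
  \forall t \near (0 : R)^'+, P D t.
Proof.
case=> -[A1 A2] [/= A1D A2t] AP; apply: filterS A2t => t A2t.
exact: (AP (D, t) (conj (nbhs_singleton A1D) A2t)).
Qed.

Lemma near2I (R : realType) (T : topologicalType) (D : T) (P Q : T -> R -> Prop) :
  (\forall D' \near D & t \near (0 : R)^'+, P D' t) ->
  (\forall D' \near D & t \near (0 : R)^'+, Q D' t) ->
  \forall D' \near D & t \near (0 : R)^'+, P D' t /\ Q D' t.
Proof. by move=> HP HQ; apply: filterS (filterI HP HQ). Qed.

Lemma near2_ex (R : realType) (T : topologicalType) (D : T) (P : T -> R -> Prop) :
  (\forall D' \near D & t \near (0 : R)^'+, P D' t) -> exists D' t, P D' t.
Proof.
move=> /near2_diag H; exists D.
exact: (@filter_ex _ _ (at_right_proper_filter (0 : R)) _ H).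
Qed.

Lemma dotE (R : realType) (N : nat) (a b : 'rV[R]_N) : dot a b = \sum_i a 0 i * b 0 i.
Proof. by rewrite /dot mxE; apply: eq_bigr => i _; rewrite mxE. Qed.

Lemma dotC (R : realType) (N : nat) (a b : 'rV[R]_N) : dot a b = dot b a.
Proof. by rewrite !dotE; apply: eq_bigr => i _; rewrite mulrC. Qed.

Lemma dotDr (R : realType) (N : nat) (a b c : 'rV[R]_N) :
  dot a (b + c) = dot a b + dot a c.
Proof. by rewrite /dot linearD /= mulmxDr mxE. Qed.

Lemma dotZr (R : realType) (N : nat) (k : R) (a b : 'rV[R]_N) :
  dot a (k *: b) = k * dot a b.
Proof. by rewrite /dot linearZ /= -scalemxAr mxE. Qed.

Lemma dotNr (R : realType) (N : nat) (a b : 'rV[R]_N) : dot a (- b) = - dot a b.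
Proof. by rewrite -scaleN1r dotZr mulN1r. Qed.

Lemma dotDl (R : realType) (N : nat) (a b c : 'rV[R]_N) :
  dot (b + c) a = dot b a + dot c a.
Proof. by rewrite dotC dotDr ![dot a _]dotC. Qed.

Lemma dotZl (R : realType) (N : nat) (k : R) (a b : 'rV[R]_N) :
  dot (k *: b) a = k * dot b a.
Proof. by rewrite dotC dotZr dotC. Qed.

Lemma dot0r (R : realType) (N : nat) (a : 'rV[R]_N) : dot a 0 = 0.
Proof. by rewrite -(scale0r 0) dotZr mul0r. Qed.

Lemma dot0l (R : realType) (N : nat) (a : 'rV[R]_N) : dot 0 a = 0.
Proof. by rewrite dotC dot0r. Qed.

Lemma dot_suml (R : realType) (N : nat) (I : Type) (r : seq I) (P : pred I)
    (X : I -> 'rV[R]_N) (a : 'rV[R]_N) :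
  dot (\sum_(i <- r | P i) X i) a = \sum_(i <- r | P i) dot (X i) a.
Proof.
by elim/big_ind2: _ => [|x y z w <- <-|//]; rewrite ?dot0l ?dotDl.
Qed.

Lemma dot_sumr (R : realType) (N : nat) (I : Type) (r : seq I) (P : pred I)
    (X : I -> 'rV[R]_N) (a : 'rV[R]_N) :
  dot a (\sum_(i <- r | P i) X i) = \sum_(i <- r | P i) dot a (X i).
Proof. by rewrite dotC dot_suml; apply: eq_bigr => i _; rewrite dotC. Qed.

Lemma dot_gt0 (R : realType) (N : nat) (a : 'rV[R]_N) : a != 0 -> 0 < dot a a.
Proof.
move=> a0; rewrite dotE lt_neqAle sumr_ge0 ?andbT; last first.
  by move=> i _; rewrite -expr2 sqr_ge0.
apply: contra a0 => /eqP/esym/psumr_eq0P H.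
apply/eqP/rowP => i; rewrite mxE; apply/eqP.
have : a 0 i * a 0 i = 0 by apply: H => // j _; rewrite -expr2 sqr_ge0.
by move/eqP; rewrite mulf_eq0 orbb.
Qed.

Lemma dot_continuous (R : realType) (N : nat) (a : 'rV[R]_N) : continuous (dot a).
Proof.
move=> v; rewrite (_ : dot a = fun b => \sum_i a 0 i * b 0 i); last first.
  by apply/funext => b; rewrite dotE.
apply: (@cvg_sum R _ _ _ (nbhs v) _ (fun i (b : 'rV[R]_N) => a 0 i * b 0 i)) => i.
by apply: cvgMr; exact: coord_continuous.
Qed.

(** The matrix with rows [X i] has independent rows, hence a right inverse; the columns of that
    inverse are the dual family. *)
Lemma free_dual (R : realType) (N : nat) (I : finType) (A : {pred I}) (X : I -> 'rV[R]_N) :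
  free [seq X i | i in A] ->
  exists B : 'M[R]_(#|A|, N), forall i k : 'I_#|A|,
    dot (X (enum_val i)) (row k B) = (i == k)%:R.
Proof.
move=> fX; pose M : 'M[R]_(#|A|, N) := \matrix_(i < #|A|) X (enum_val i).
have /row_freeP[B MB] : row_free M.
  apply: inj_row_free => v vM; apply/rowP => i; rewrite mxE.
  have /freeP := (fX : free (image_tuple X A)); apply.
  rewrite -[RHS]vM mulmx_sum_row; apply: eq_bigr => j _.
  by rewrite nth_image rowK.
exists B^T => i k; move/matrixP/(_ i k): MB; rewrite !mxE => <-.
by rewrite dotE; apply: eq_bigr => j _; rewrite !mxE.
Qed.

(** The corrected direction [D' + a *m B] is again close to [D], so it inherits whatever holds for
    directions near [D]; [Q] carries such properties through the correction. *)
Lemma implicit_ray_near (R : realType) (N c : nat) (A : set 'rV[R]_N)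
    (h : 'I_c -> 'rV[R]_N -> R) (s D : 'rV[R]_N) (B : 'M[R]_(c, N))
    (Q : 'rV[R]_N -> R -> Prop) :
    open A -> A s -> (forall i, C1_on A (h i)) -> (forall i, h i s = 0) ->
    (forall i, dot (grad (h i) s) D = 0) ->
    (forall i k, dot (grad (h i) s) (row k B) = (i == k)%:R) ->
    (\forall D' \near D & t \near (0 : R)^'+, Q D' t) ->
  \forall D' \near D & t \near (0 : R)^'+, exists a : 'rV[R]_c,
    [/\ Q (D' + a *m B) t, A (s + t *: (D' + a *m B))
      & forall i, h i (s + t *: (D' + a *m B)) = 0].
Proof.
move=> oA As h1 hs hD hB [[/= Q1 Q2] [/= /nbhs_ballP[r /= r0 Q1D] Q2t] QQ].
pose b : R := \sum_k `|row k B|.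
have b0 : 0 <= b by apply: sumr_ge0.
(* Gives [|a *m B| <= e * b <= r / 2]; the other half of [r] is left for [D']. *)
pose e := r / (2 * (b + 1)).
have e0 : 0 < e by rewrite divr_gt0 // mulr_gt0 // ltr_wpDl.
have dh i : differentiable (h i) s by have [] := h1 i s As.
have hD' i : 'D_D (h i) s = 0 by rewrite derive_dot.
have hB' i k : 'D_(row k B) (h i) s = (i == k)%:R by rewrite derive_dot.
have [[/= U1 U2] [/= U1D U2t] UU] := implicit_ray oA As h1 hs hD' hB' e0.
exists (U1 `&` ball D (r / 2), U2 `&` Q2).
  split; apply: filterI => //=; apply/nbhs_ballP; exists (r / 2) => //=.
  exact: divr_gt0.
move=> [D' t] /= [[U1D' DD'] [U2t' Q2t']].
have [a [ae As' hs']] := UU (D', t) (conj U1D' U2t').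
exists a; split=> //; apply: (QQ (_, _)); split=> //=.
apply: Q1D; move: DD'; rewrite -!ball_normE /= => DD'.
rewrite opprD addrA; apply: le_lt_trans (ler_normB _ _) _.
rewrite [ltRHS](splitr r); apply: ltr_leD => //.
rewrite mulmx_sum_row; apply: le_trans (ler_norm_sum _ _ _) _.
apply: (@le_trans _ _ (e * b)).
  rewrite /b mulr_sumr; apply: ler_sum => k _; rewrite normrZ ler_wpM2r //.
  exact: (rV_norm_leP a (ltW e0) ae).
rewrite /e invfM mulrA -mulrA ler_piMr //; first by rewrite divr_ge0 // ltW.
by rewrite mulrC ler_pdivrMr ?mul1r ?lerDl // ltr_wpDl.
Qed.

Lemma derive_right (R : realType) (N : nat) (h : 'rV[R]_N -> R) (p v : 'rV[R]_N) :
  derivable h p v -> t^-1 * (h (p + t *: v) - h p) @[t --> (0 : R)^'+] --> ('D_v h p : R).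
Proof.
move=> dh; apply: cvg_dnbhs_at_right.
have E : (fun t : R => t^-1 * (h (p + t *: v) - h p)) =
   (fun t : R => t^-1 *: (h (t *: v + p) - h p)).
  by apply/funext => t; rewrite [p + _]addrC.
by rewrite E; exact: dh.
Qed.

(** Let [z0] be farthest from the origin and [z0 + e] another point of [S]. The segment between them
    makes [e] tangent at [z0]. Tangent directions of a submanifold come with their opposites, so [S]
    has points in directions close to [- e], and these are farther away. Distance is the Euclidean
    [dot z z]; under the maximum norm of row vectors [e] need not point strictly inwards. *)
Lemma submanifold_convex_compact (R : realType) (N : nat) (S : set 'rV[R]_N) :
    compact S ->
    (forall x y, S x -> S y -> forall t : R, 0 <= t <= 1 -> S (x + t *: (y - x))) ->
    (forall z, S z -> exists2 V, nbhs z V & C1_submanifold (S `&` V)) ->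
  forall x y, S x -> S y -> x = y.
Proof.
move=> cS xS mS.
have farthest_unique (z0 z1 : 'rV[R]_N) : S z0 -> S z1 ->
    (forall z, S z -> dot z z <= dot z0 z0) -> z1 = z0.
  move=> Sz0 Sz1 z0max; apply/eqP; rewrite -subr_eq0; apply/negPn/negP => e0.
  have [e ze] : exists e, z1 = z0 + e by exists (z1 - z0); rewrite addrC subrK.
  rewrite {}ze in Sz1 e0; have {}e0 : e != 0 by rewrite addrC addKr in e0.
  (* Expanding [dot (z0 + e) (z0 + e) <= dot z0 z0] gives [2 * dot z0 e <= - dot e e], which is
     negative. *)
  have z0e : dot z0 e < 0.
    have := z0max _ Sz1; have := dot_gt0 e0.
    by rewrite dotDr !dotDl [dot e z0]dotC; lra.
  have [V z0V [c /(_ z0 (conj Sz0 (nbhs_singleton z0V)))]] := mS z0 Sz0.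
  case=> V' [h [oV' V'z0 h1 SE]] /(_ _ V'z0) fh.
  have hz0 i : h i z0 = 0.
    suff : (V' `&` [set z' | forall i, h i z' = 0]) z0 by case.
    have : ((S `&` V) `&` V') z0 by do 2!split=> //; exact: nbhs_singleton.
    by rewrite SE.
  (* Near [z0] each [h i] vanishes on the segment towards [z0 + e], so its right derivative along
     [e] is 0. *)
  have he i : dot (grad (h i) z0) (- e) = 0.
    have [dhi _] := h1 i z0 V'z0.
    rewrite dotNr -derive_dot //; apply/eqP; rewrite oppr_eq0; apply/eqP.
    have dv : derivable (h i) z0 e by exact: diff_derivable.
    have := derive_right dv; move/(norm_cvg_unique); apply.
    apply: cvg_near_cst.
    have nVV : nbhs z0 (V `&` V') by apply: filterI => //; exact: open_nbhs_nbhs.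
    have nVV2 : \forall yv \near (z0, e), (V `&` V') yv.1.
      exact: (@cvg_fst _ _ (nbhs z0) (nbhs e)).
    have nt := near2_diag (near_ray `|e| nVV2); near=> t.
    have [] : [/\ `|e| <= `|e| + 1, 0 < t & forall w, `|w| <= `|e| -> (V `&` V') (z0 + t *: w)].
      by near: t; exact: nt.
    move=> _ t0 /(_ e (lexx _)) [Vt V't].
    have : ((S `&` V) `&` V') (z0 + t *: e).
      split=> //; split=> //.
      rewrite -[e](addKr z0) [- z0 + _]addrC; apply: xS => //; rewrite ltW //=.
      by near: t; apply: nbhs_right_le.
    by rewrite SE => -[_ ->]; rewrite hz0 subrr mulr0.
  (* Directions near [- e] still have a positive product with [z0], so moving along them strictly
     increases the distance to the origin. *)
  have nQ : \forall D' \near - e & t \near (0 : R)^'+,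
      [/\ 0 < t, V (z0 + t *: D') & 0 < dot z0 D'].
    have nVd : \forall yv \near (z0, - e), V yv.1 /\ 0 < dot z0 yv.2.
      apply: filterI; first exact: (@cvg_fst _ _ (nbhs z0) (nbhs (- e))).
      apply: (@cvg_snd _ _ (nbhs z0) (nbhs (- e)) _ [set v | 0 < dot z0 v]).
      apply: (cvgr_gt _ (@dot_continuous _ _ z0 (- e))).
      by rewrite dotNr oppr_gt0.
    apply: filterS (near_ray (`|- e| + 1) nVd) => -[D' t] /= [D'1 t0 H].
    by have [] := H D' D'1.
  have [B hB] := free_dual fh.
  have [D' [t]] := near2_ex (implicit_ray_near (h := fun k => h (enum_val k)) oV' V'z0
    (fun k => h1 _) (fun k => hz0 _) (fun k => he _) hB nQ).
  case=> a [[t0 Vw z0w] V'w hw]; move: (D' + a *m B) => w in Vw z0w V'w hw.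
  have : (V' `&` [set z' | forall i, h i z' = 0]) (z0 + t *: w).
    by split=> // i; rewrite -(enum_rankK i); exact: hw.
  rewrite [_ `&` _](_ : _ = [set z' | V' z' /\ forall i, h i z' = 0]) // -SE => -[[Sw _] _].
  have := z0max _ Sw; rewrite dotDr !dotDl dotZr !dotZl dotZr [dot w z0]dotC.
  apply/negP; rewrite -ltNge.
  have w0 : 0 <= dot w w.
    by have [->|/dot_gt0/ltW//] := eqVneq w 0; rewrite dot0r.
  have := mulr_gt0 t0 z0w; have : 0 <= t * (t * dot w w) by rewrite !mulr_ge0 // ltW.
  lra.
move=> x y Sx Sy.
have [z0 /set_mem Sz0 z0max] : exists2 z0, z0 \in S & forall z, z \in S -> dot z z <= dot z0 z0.
  apply: compact_EVT_max => //; first by exists x.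
  apply: continuous_subspaceT => v.
  have -> : (fun z : 'rV[R]_N => dot z z) = (fun z : 'rV[R]_N => \sum_i z 0 i * z 0 i).
    by apply/funext => z; rewrite dotE.
  apply: (@cvg_sum R _ _ _ (nbhs v) _ (fun i (b : 'rV[R]_N) => b 0 i * b 0 i)) => i.
  by apply: cvgM; exact: coord_continuous.
have zm z : S z -> dot z z <= dot z0 z0 by move=> /mem_set; exact: z0max.
by rewrite (farthest_unique z0 x) // (farthest_unique z0 y).
Unshelve. all: end_near. Qed.

(** * Functions of two vector variables *)

Lemma row_mx_norm_le (R : realType) (n m : nat) (a : 'rV[R]_n) (b : 'rV[R]_m) (r : R) :
  `|a| <= r -> `|b| <= r -> `|row_mx a b| <= r.
Proof.
move=> ar br; have r0 := le_trans (normr_ge0 a) ar.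
apply/rV_norm_leP => // k; rewrite mxE; case: splitP => j _.
  exact: (rV_norm_leP a r0 ar).
exact: (rV_norm_leP b r0 br).
Qed.

Section joint.
Variables (R : realType) (n m : nat).
Implicit Types (f : 'rV[R]_n -> 'rV[R]_m -> R) (x a : 'rV[R]_n) (z b : 'rV[R]_m).

Lemma joint_row f x z : joint f (row_mx x z) = f x z.
Proof. by rewrite /joint row_mxKl row_mxKr. Qed.

Lemma joint_ray f x z (t : R) (d : 'rV[R]_(n + m)) :
  joint f (row_mx x z + t *: d) = f (x + t *: lsubmx d) (z + t *: rsubmx d).
Proof. by rewrite /joint !linearD !linearZ /= row_mxKl row_mxKr. Qed.

Lemma derive_joint1 f x z a : 'D_(row_mx a 0) (joint f) (row_mx x z) = 'D_a (f^~ z) x.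
Proof.
rewrite /derive; set u := fun t : R => _; set v := fun t : R => _.
rewrite (_ : u = v) //; apply/funext => t; rewrite /u /v /= joint_row.
by rewrite [_ *: row_mx _ _ + _]addrC joint_ray row_mxKl row_mxKr scaler0 addr0 [x + _]addrC.
Qed.

Lemma derive_joint2 f x z b : 'D_(row_mx 0 b) (joint f) (row_mx x z) = 'D_b (f x) z.
Proof.
rewrite /derive; set u := fun t : R => _; set v := fun t : R => _.
rewrite (_ : u = v) //; apply/funext => t; rewrite /u /v /= joint_row.
by rewrite [_ *: row_mx _ _ + _]addrC joint_ray row_mxKl row_mxKr scaler0 addr0 [z + _]addrC.
Qed.

Lemma gradientE f x z : gradient f x z = row_mx (grad1 f x z) (grad2 f x z).
Proof.
apply/rowP => k; rewrite -(splitK k); case: (fintype.split k) => j /=.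
  by rewrite row_mxEl !mxE delta_mx_lshift derive_joint1.
by rewrite row_mxEr !mxE delta_mx_rshift derive_joint2.
Qed.

Lemma dot_row a b x z : dot (row_mx a b) (row_mx x z) = dot a x + dot b z.
Proof. by rewrite /dot tr_row_mx mul_row_col mxE. Qed.

Lemma dot_gradient f x z (d : 'rV[R]_(n + m)) : dot (gradient f x z) d =
  dot (grad1 f x z) (lsubmx d) + dot (grad2 f x z) (rsubmx d).
Proof. by rewrite gradientE -{1}[d]hsubmxK dot_row. Qed.

Lemma grad_joint f x z : grad (joint f) (row_mx x z) = row_mx (grad1 f x z) (grad2 f x z).
Proof. exact: gradientE. Qed.

End joint.

(** * Stability of C^1 and C^2 under linear combinations *)

Section C2_closure.
Variables (R : realType) (N : nat).
Implicit Types f g : 'rV[R]_N -> R.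

Lemma C1_deriveD f g v : C1_on setT f -> C1_on setT g ->
  'D_v (f + g) = 'D_v f + 'D_v g.
Proof.
move=> f1 g1; apply/funext => y; have [dy _] := f1 y I; have [dy' _] := g1 y I.
by rewrite deriveD //; exact: diff_derivable.
Qed.

Lemma C1_deriveZ (k : R) f v : C1_on setT f -> 'D_v (k *: f) = k *: 'D_v f.
Proof.
move=> f1; apply/funext => y; have [dy _] := f1 y I.
by rewrite deriveZ //; exact: diff_derivable.
Qed.

Lemma C1D f g : C1_on setT f -> C1_on setT g -> C1_on setT (f + g).
Proof.
move=> f1 g1 x _; have [dfx cf] := f1 x I; have [dgx cg] := g1 x I.
split=> [|v]; first exact: differentiableD.
by rewrite C1_deriveD //; apply: continuousD; [exact: cf|exact: cg].
Qed.

Lemma C1Z (k : R) f : C1_on setT f -> C1_on setT (k *: f).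
Proof.
move=> f1 x _; have [dfx cf] := f1 x I.
split=> [|v]; first exact: differentiableZ.
by rewrite C1_deriveZ //; apply: continuousZr; exact: cf.
Qed.

Lemma C2D f g : C2 f -> C2 g -> C2 (f + g).
Proof.
move=> [f1 f2] [g1 g2]; split; first exact: C1D.
move=> v; exact: (eq_ind_r (C1_on setT) (C1D (f2 v) (g2 v)) (C1_deriveD v f1 g1)).
Qed.

Lemma C2Z (k : R) f : C2 f -> C2 (k *: f).
Proof.
move=> [f1 f2]; split; first exact: C1Z.
move=> v; exact: (eq_ind_r (C1_on setT) (C1Z k (f2 v)) (C1_deriveZ k v f1)).
Qed.

Lemma derive_cst_fun (k : R) (v : 'rV[R]_N) : 'D_v (cst k : 'rV[R]_N -> R) = cst 0.
Proof. by apply/funext => y; rewrite derive_cst. Qed.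

Lemma C1_cst (k : R) : C1_on setT (cst k : 'rV[R]_N -> R).
Proof. by move=> x _; split=> // v; rewrite derive_cst_fun; exact: cst_continuous. Qed.

Lemma C2_cst (k : R) : C2 (cst k : 'rV[R]_N -> R).
Proof.
split; first exact: C1_cst.
move=> v; exact: (eq_ind_r (C1_on setT) (C1_cst 0) (derive_cst_fun k v)).
Qed.

Lemma C2_sum (I : Type) (r : seq I) (P : pred I) (h : I -> 'rV[R]_N -> R) :
  (forall i, C2 (h i)) -> C2 (\sum_(i <- r | P i) h i).
Proof.
by move=> h2; apply: (big_ind (fun h => C2 h)); [exact: (C2_cst 0)|exact: C2D|].
Qed.

Lemma derive_lincomb (q : nat) (c : 'I_q -> R) (h : 'I_q -> 'rV[R]_N -> R) v y :
  (forall i, C1_on setT (h i)) ->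
  'D_v (\sum_i c i *: h i) y = \sum_i c i * 'D_v (h i) y.
Proof.
move=> h1; have dh i : derivable (h i) y v by apply: diff_derivable; have [] := h1 i y I.
rewrite derive_sum; last by move=> i; exact: derivableZ.
by apply: eq_bigr => i _; rewrite deriveZ.
Qed.

End C2_closure.

(** * The lower-level problem *)

Lemma convex_segment (R : realType) (N : nat) (h : 'rV[R]_N -> R) :
  convex_function setT h -> forall x y (t : R), 0 <= t <= 1 ->
  h (x + t *: (y - x)) <= h x + t * (h y - h x).
Proof.
move=> hc x y t /andP[t0 t1].
have := hc (Itv01 t0 t1) y x (mem_set I) (mem_set I).
rewrite convRE /= => H; apply: le_trans (le_trans _ H) _; last by rewrite /unstable.onem; lra.
rewrite le_eqVlt; apply/orP; left; apply/eqP; congr h.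
change (x + t *: (y - x) = t *: y + (1 - t) *: x).
by rewrite scalerBr scalerBl scale1r addrCA.
Qed.

Section lower_level.
Context (R : realType) (n m q : nat) (f : 'rV[R]_n -> 'rV[R]_m -> R)
  (g : 'I_q -> 'rV[R]_n -> 'rV[R]_m -> R).

Lemma row_mx_cvg (x : 'rV[R]_n) (z : 'rV[R]_m) : row_mx x y @[y --> z] --> row_mx x z.
Proof.
apply/(@cvgrPdist_lt _ _ _ (nbhs z) (nbhs_filter z)) => e e0.
apply/nbhs_ballP; exists e => // z'.
rewrite -ball_normE /= => zz'; rewrite opp_row_mx add_row_mx subrr.
by apply: le_lt_trans zz'; apply: row_mx_norm_le => //; rewrite normr0.
Qed.

Lemma joint_continuous2 (h : 'rV[R]_n -> 'rV[R]_m -> R) x :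
  C2 (joint h) -> continuous (h x).
Proof.
move=> [h1 _] z.
have hc : {for row_mx x z, continuous (joint h)}.
  by apply: differentiable_continuous; have [] := h1 (row_mx x z) I.
have -> : h x = joint h \o row_mx x by apply/funext => y; rewrite /= joint_row.
apply: continuous_comp.
  exact: row_mx_cvg.
exact: hc.
Qed.

Lemma joint_ell (w : 'rV[R]_q) :
  joint (ell f g w) = joint f + \sum_j w 0 j *: joint (g j).
Proof. by apply/funext => s; rewrite /joint /ell /= fctE fct_sumE. Qed.

Lemma C2_ell (w : 'rV[R]_q) : C2 (joint f) -> (forall j, C2 (joint (g j))) ->
  C2 (joint (ell f g w)).
Proof.
move=> f2 g2; have gs := C2_sum (index_enum 'I_q) xpredT (fun j => C2Z (w 0 j) (g2 j)).
exact: (eq_ind_r _ (C2D f2 gs) (joint_ell w)).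
Qed.

Lemma complementary_eq0 (N : nat) (w : 'rV[R]_N) (a : 'I_N -> R) :
  complementary w a -> forall j, w 0 j * a j = 0.
Proof.
case=> w0 a0 s0 j; apply/eqP; rewrite -oppr_eq0; apply/eqP.
have /psumr_eq0P : forall i : 'I_N, true -> 0 <= - (w 0 i * a i).
  by move=> i _; rewrite oppr_ge0 mulr_ge0_le0.
by apply => //; rewrite sumrN s0 oppr0.
Qed.

Lemma Sol_segment x : convex_function setT (f x) ->
  (forall j, convex_function setT (g j x)) -> forall z z', Sol f g x z -> Sol f g x z' ->
  forall t : R, 0 <= t <= 1 -> Sol f g x (z + t *: (z' - z)).
Proof.
move=> fc gc z z' [Kz zmin] [Kz' z'min] t t01; have /andP[t0 t1] := t01.
split=> [j|z'' Kz''].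
  apply: le_trans (convex_segment (gc j) _ _ t01) _.
  have := mulr_ge0_le0 t0 (Kz' j).
  have : (1 - t) * g j x z <= 0 by rewrite mulr_ge0_le0 // ?subr_ge0 //; exact: Kz.
  lra.
apply: le_trans (convex_segment fc _ _ t01) _.
by have := z'min _ Kz; have := zmin _ Kz'; have := zmin _ Kz'' => h1 h2 h3; nra.
Qed.

(** Given a minimizer [z0], the solution set is cut out by the closed conditions [g j x z <= 0] and
    [f x z <= f x z0], inside a compact closure of feasible sets. *)
Lemma Sol_compact x : C2 (joint f) -> (forall j, C2 (joint (g j))) ->
  uniformly_compact g x -> Sol f g x !=set0 -> compact (Sol f g x).
Proof.
move=> f2 g2 [U [xU cU]] [z0 [Kz0 z0min]].
have SE : Sol f g x = \bigcap_(j in setT) (g j x @^-1` [set r | r <= 0]) `&`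
    (f x @^-1` [set r | r <= f x z0]).
  apply/seteqP; split=> [z [Kz zmin]|z [Kz fz]]; first by split=> [j _|]; [exact: Kz|exact: zmin].
  split=> [j|z' Kz']; first exact: Kz.
  exact: le_trans fz (z0min _ Kz').
apply: subclosed_compact cU _.
  rewrite SE; apply: closedI.
    apply: closed_bigI => j _; apply: closed_comp; last exact: closed_le.
    by move=> z _; exact: (joint_continuous2 (g2 j)).
  apply: closed_comp; last exact: closed_le.
  by move=> z _; exact: (joint_continuous2 f2).
move=> z [Kz _]; apply: subset_closure; exists x => //; exact: nbhs_singleton.
Qed.

(** Sufficiency of the Karush-Kuhn-Tucker conditions under convexity: [ell] is convex in the
    lower-level variable with zero gradient at [z], hence minimal there; it equals [f] at [z] by
    complementarity and lies below [f] on [K x]. The stationarity system does not itself say that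
    [zb] solves the lower-level problem; this does. *)
Lemma Lambda_Sol x z w : C2 (joint f) -> (forall j, C2 (joint (g j))) ->
  convex_function setT (f x) -> (forall j, convex_function setT (g j x)) ->
  Lambda f g x z w -> Sol f g x z.
Proof.
move=> f2 g2 fc gc [dl cw]; have [w0 Kz _] := cw.
split=> // z' Kz'.
have lz : ell f g w x z = f x z.
  by rewrite /ell big1 ?addr0 // => j _; exact: (complementary_eq0 cw).
have lz' : ell f g w x z' <= f x z'.
  by rewrite gerDl sumr_le0 // => j _; rewrite mulr_ge0_le0.
rewrite -lz; apply: le_trans lz'.
have d : differentiable (joint (ell f g w)) (row_mx x z).
  by have [l1 _] := C2_ell w f2 g2; have [] := l1 (row_mx x z) I.
have D0 : 'D_(row_mx 0 (z' - z)) (joint (ell f g w)) (row_mx x z) = 0.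
  by rewrite derive_dot // grad_joint dl dot_row dot0r dot0l addr0.
have lc (t : R) : 0 <= t <= 1 ->
    ell f g w x (z + t *: (z' - z)) <= ell f g w x z + t * (ell f g w x z' - ell f g w x z).
  move=> t01; rewrite /ell.
  apply: le_trans (lerD (convex_segment fc z z' t01) (_ : _ <=
     \sum_j w 0 j * (g j x z + t * (g j x z' - g j x z)))) _.
    by apply: ler_sum => j _; rewrite ler_wpM2l //; exact: convex_segment.
  rewrite le_eqVlt; apply/orP; left; apply/eqP.
  under eq_bigr do rewrite mulrDr mulrCA mulrBr.
  rewrite big_split /= -mulr_sumr sumrB; ring.
have dd := @diff_derivable _ _ _ _ _ (row_mx 0 (z' - z)) d.
have cv := derive_right dd; rewrite D0 in cv.
rewrite -subr_ge0; apply: cvgr_to_le cv _; near=> t.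
have t0 : 0 < t by near: t; exact: nbhs_right_gt.
have t1 : t <= 1 by near: t; exact: nbhs_right_le.
rewrite mulrC ler_pdivrMr // !joint_row joint_ray row_mxKl row_mxKr scaler0 addr0.
by rewrite lerBlDl mulrC; apply: lc; rewrite ltW.
Unshelve. all: end_near. Qed.

Lemma derive_ell w (v y : 'rV[R]_(n + m)) : C2 (joint f) -> (forall j, C2 (joint (g j))) ->
  'D_v (joint (ell f g w)) y = 'D_v (joint f) y + \sum_j w 0 j * 'D_v (joint (g j)) y.
Proof.
move=> [f1 _] g2; have g1 j : C1_on setT (joint (g j)) by have [] := g2 j.
have gs := C2_sum (index_enum 'I_q) xpredT (fun j => C2Z (w 0 j) (g2 j)).
have -> : 'D_v (joint (ell f g w)) y = 'D_v (joint f + \sum_j w 0 j *: joint (g j)) y.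
  exact: (congr1 (fun h => 'D_v h y) (joint_ell w)).
have -> := congr1 (fun h => h y) (C1_deriveD v f1 gs.1).
exact: (congr1 (fun r => 'D_v (joint f) y + r) (derive_lincomb (fun j => w 0 j) v y g1)).
Qed.

(** Both multipliers vanish off the active set, and their difference yields a vanishing combination
    of active gradients; pairing it with a dual direction isolates one coefficient. This identifies
    [mult], a choice made by [xget], with [wb]. *)
Lemma Lambda_unique x z w w' : C2 (joint f) -> (forall j, C2 (joint (g j))) ->
  LLICQ g x z -> Lambda f g x z w -> Lambda f g x z w' -> w = w'.
Proof.
move=> f2 g2 li [dw cw] [dw' cw'].
have w0 (u : 'rV[R]_q) j : complementary u (fun j => g j x z) -> j \notin active g x z -> u 0 j = 0.
  move=> /complementary_eq0/(_ j)/eqP; rewrite mulf_eq0 inE => /orP[/eqP//|->//].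
have dg j b : 'D_(row_mx 0 b) (joint (g j)) (row_mx x z) = dot (grad2 (g j) x z) b.
  rewrite derive_dot; last by have [g1 _] := g2 j; have [] := g1 (row_mx x z) I.
  by rewrite grad_joint dot_row dot0r add0r.
have dl (u : 'rV[R]_q) b : grad2 (ell f g u) x z = 0 ->
    'D_(row_mx 0 b) (joint (ell f g u)) (row_mx x z) = 0.
  move=> du; have [l1 _] := C2_ell u f2 g2.
  rewrite derive_dot; last by have [] := l1 (row_mx x z) I.
  by rewrite grad_joint dot_row dot0r du dot0l addr0.
have [B hB] := free_dual li.
apply/rowP => j; have [jA|jA] := boolP (j \in active g x z); last by rewrite !w0.
have S0 b : \sum_j (w 0 j - w' 0 j) * dot (grad2 (g j) x z) b = 0.
  have := dl _ b dw; have := dl _ b dw'; rewrite !(derive_ell _ _ _ f2 g2).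
  under eq_bigr do rewrite dg; move=> E'; under eq_bigr do rewrite dg; move=> E.
  under eq_bigr do rewrite mulrBl.
  by rewrite sumrB; apply/eqP; rewrite subr_eq0; apply/eqP;
     apply: (addrI ('D_(row_mx 0 b) (joint f) (row_mx x z))); rewrite E E'.
have := S0 (row (enum_rank_in jA j) B).
rewrite (bigD1 j) //= big1 ?addr0 => [|i ij].
  have := hB (enum_rank_in jA j) (enum_rank_in jA j).
  by rewrite enum_rankK_in // eqxx => ->; rewrite mulr1 => /eqP; rewrite subr_eq0 => /eqP.
have [iA|iA] := boolP (i \in active g x z); last by rewrite !w0 // subrr mul0r.
have := hB (enum_rank_in jA i) (enum_rank_in jA j).
rewrite enum_rankK_in // => ->; rewrite (_ : (_ == _) = false) ?mulr0 //.
apply/negbTE; apply: contra ij => /eqP E; apply/eqP.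
by rewrite -(enum_rankK_in jA iA) E enum_rankK_in.
Qed.

(** The equations are solved by a combination of directions dual to the active gradients. *)
Lemma Zset_nonempty x z delta : LLICQ g x z -> Zset g delta x z !=set0.
Proof.
move=> /free_dual[B hB].
exists (\sum_k - dot (grad1 (g (enum_val k)) x z) delta *: row k B) => j jA.
rewrite dot_sumr (bigD1 (enum_rank_in jA j)) //= big1 ?addr0 => [|i ij].
  have := hB (enum_rank_in jA j) (enum_rank_in jA j).
  by rewrite dotZr enum_rankK_in // eqxx => ->; rewrite mulr1 addrN.
have := hB (enum_rank_in jA j) i.
by rewrite dotZr enum_rankK_in // eq_sym (negbTE ij) => ->; rewrite mulr0.
Qed.

(** The corrected point [z'] makes the active constraints vanish and keeps the inactive ones
    nonpositive, so it is feasible and [phi] is at most [f] there. By complementarity [f] equals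
    [ell] at that point, and [ell] is expanded to second order. *)
Lemma phi_ray x z w (d : 'rV[R]_(n + m)) (e : 'rV[R]_m) (eps : R) :
    C2 (joint f) -> (forall j, C2 (joint (g j))) -> (forall x', Sol f g x' !=set0) ->
    LLICQ g x z -> Lambda f g x z w -> Zset g (lsubmx d) x z e -> 0 < eps ->
  \forall d' \near d & t \near (0 : R)^'+,
    phi f g (x + t *: lsubmx d') <= f x z
      + t * dot (grad1 (ell f g w) x z) (lsubmx d')
      + t ^+ 2 / 2 * quad (hessian (ell f g w) x z) (row_mx (lsubmx d) e)
      + t ^+ 2 * eps.
Proof.
move=> f2 g2 Sol0 /free_dual[B2 hB2] [dw cw] eZ eps0.
pose s := row_mx x z; pose D := row_mx (lsubmx d) e.
have l2 := C2_ell w f2 g2; have [w0 Kz _] := cw.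
(* The zero block leaves the first variable exactly at [x + t *: lsubmx d']; only the lower-level
   variable is corrected. *)
pose B := row_mx (0 : 'M[R]_(_, n)) B2.
have nK : \forall D' \near D & t \near (0 : R)^'+,
    forall j, j \notin active g x z -> joint (g j) (s + t *: D') <= 0.
  have nk : \forall yv \near (s, D), forall j, j \notin active g x z -> joint (g j) yv.1 <= 0.
    apply: (@filter_forall _ _ (fun j (yv : 'rV[R]_(n + m) * 'rV[R]_(n + m)) =>
      j \notin active g x z -> joint (g j) yv.1 <= 0) _ (nbhs_filter (s, D))) => j.
    have [jA|jA] := boolP (j \in active g x z); first by apply: filterE.
    have gj : joint (g j) s < 0 by rewrite joint_row lt_neqAle Kz; move: jA; rewrite inE => ->.
    have [g1 _] := g2 j; have [/differentiable_continuous gc _] := g1 s I.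
    apply: (@cvg_fst _ _ (nbhs s) (nbhs D) _ [set y | ~~ false -> joint (g j) y <= 0]).
    have gn : \forall y \near s, joint (g j) y <= 0 by exact: (cvgr_le _ gc).
    by apply: filterS gn => y yle _; exact: yle.
  apply: filterS (near_ray (`|D| + 1) nk) => -[D' t] /= [D'1 _ H].
  by move=> j; exact: H.
have nQ := near2I (C2_ray s D l2 eps0) nK.
have g1 j : C1_on setT (joint (g j)) by have [] := g2 j.
have N := @implicit_ray_near R (n + m) #|active g x z| setT
  (fun k => joint (g (enum_val k))) s D B _ openT I (fun k => g1 _) _ _ _ nQ.
have {N nQ nK} [k|k|i k|[U1 U2] /= [/nbhs_ballP[r /= r0 U1D] U2t] UU] := N.
- rewrite joint_row; apply/eqP; have := enum_valP k; by rewrite inE.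
- by rewrite grad_joint dot_row; apply: eZ; exact: enum_valP.
- by rewrite grad_joint row_row_mx row0 dot_row dot0r add0r.
exists (ball d r, U2); first by split=> //; apply/nbhs_ballP; exists r.
move=> [d' t] /= [dd' U2t'].
have [|a [[taylor inact] _ act]] := UU (row_mx (lsubmx d') e, t).
  split=> //; apply: U1D; move: dd'; rewrite -!ball_normE /= opp_row_mx add_row_mx subrr.
  apply: le_lt_trans; apply: row_mx_norm_le; last by rewrite normr0.
  rewrite -linearB /=; apply/rV_norm_leP => // k; rewrite mxE.
  exact: (rV_norm_leP _ (normr_ge0 _) (lexx _)).
rewrite /= in taylor inact act.
have aB : a *m B = row_mx 0 (a *m B2) by rewrite mul_mx_row mulmx0.
rewrite {}aB add_row_mx addr0 in taylor inact act.
set z' := z + t *: (e + a *m B2).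
have jE h : joint h (s + t *: row_mx (lsubmx d') (e + a *m B2)) = h (x + t *: lsubmx d') z'.
  by rewrite joint_ray row_mxKl row_mxKr.
have Kz' j : g j (x + t *: lsubmx d') z' <= 0.
  rewrite -jE; have [jA|jA] := boolP (j \in active g x z); last exact: inact.
  by have := act (enum_rank_in jA j); rewrite enum_rankK_in // => ->.
have phile : phi f g (x + t *: lsubmx d') <= f (x + t *: lsubmx d') z'.
  by have [z1 Sz1] := Sol0 (x + t *: lsubmx d'); rewrite /phi (minvalE Sz1); apply: Sz1.2.
apply: le_trans phile _.
have lz : ell f g w x z = f x z.
  by rewrite /ell big1 ?addr0 // => j _; exact: (complementary_eq0 cw).
have lz' : ell f g w (x + t *: lsubmx d') z' = f (x + t *: lsubmx d') z'.
  rewrite /ell big1 ?addr0 // => j _.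
  have [jA|jA] := boolP (j \in active g x z); last first.
    have /eqP := complementary_eq0 cw j; rewrite mulf_eq0.
    by move: jA; rewrite inE => /negbTE ->; rewrite orbF => /eqP ->; rewrite mul0r.
  by have := act (enum_rank_in jA j); rewrite enum_rankK_in // jE => ->; rewrite mulr0.
have dl : differentiable (joint (ell f g w)) s by have [l1 _] := l2; have [] := l1 s I.
move: taylor; rewrite jE lz' joint_row lz (derive_dot _ dl) grad_joint dot_row dw dot0l addr0.
rewrite -/D => /ler_normlW.
rewrite /hessian -/s -/D; lra.
Qed.
End lower_level.

(** * The penalized problem *)

(** Disposes of directions along which an active constraint grows: nearby rays contain no feasible
    point for small [t]. *)
Lemma active_ray_gt0 (R : realType) (n m : nat) (h : 'rV[R]_n -> 'rV[R]_m -> R)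
    (x : 'rV[R]_n) (y : 'rV[R]_m) (d : 'rV[R]_(n + m)) :
  C2 (joint h) -> h x y = 0 -> 0 < dot (gradient h x y) d ->
  \forall d' \near d & t \near (0 : R)^'+,
    0 < h (x + t *: lsubmx d') (y + t *: rsubmx d').
Proof.
move=> [h1 _] h0 hd; pose s := row_mx x y.
have dh : differentiable (joint h) s by have [] := h1 s I.
rewrite /gradient -/s -derive_dot // in hd.
have nT : \forall yv \near (s, d), setT yv by exact: filterE.
have nE : \forall d' \near d & t \near (0 : R)^'+, 0 < t.
  by apply: filterS (near_ray 0 nT) => -[d' t] [].
have e0 : 0 < 'D_d (joint h) s / 2 by rewrite divr_gt0.
apply: filterS (near2I nE (C1_ray s d h1 e0)) => -[d' t] /= [t0].
rewrite joint_ray joint_row h0 subr0 -[leRHS]mulrC => /ler_normlP[H _].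
have : 0 < t * ('D_d (joint h) s / 2) by rewrite mulr_gt0.
lra.
Qed.

Section lagrangian.
Context (R : realType) (n m p q : nat) (F f : 'rV[R]_n -> 'rV[R]_m -> R)
  (G : 'I_p -> 'rV[R]_n -> 'rV[R]_m -> R)
  (g : 'I_q -> 'rV[R]_n -> 'rV[R]_m -> R) (lambda : R).

Lemma C2_Lbar (I : {set 'I_p}) (J : {set 'I_q}) kappa (u : 'rV[R]_p) (v : 'rV[R]_q) :
  C2 (joint F) -> C2 (joint f) -> (forall i, C2 (joint (G i))) -> (forall j, C2 (joint (g j))) ->
  C2 (joint (Lbar F f G g lambda I J kappa u v)).
Proof.
move=> F2 f2 G2 g2.
have H := C2Z kappa (C2D F2 (C2Z lambda f2)).
have Gs := C2_sum (index_enum 'I_p) (mem I) (fun i => C2Z (u 0 i) (G2 i)).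
have gs := C2_sum (index_enum 'I_q) (mem J) (fun j => C2Z (v 0 j) (g2 j)).
apply: (eq_ind_r _ (C2D (C2D H Gs) gs)).
apply/funext => s; rewrite /joint /Lbar.
by rewrite !fctE !fct_sumE.
Qed.

(* This also covers h unbounded below on A, where minval A h is the junk value 0. *)
Lemma minval_gt (T : Type) (A : set T) (h : T -> R) (c r : R) : 0 <= c -> A !=set0 ->
  c * minval A h < r -> exists2 e, A e & c * h e < r.
Proof.
move=> c0 A0 hr; apply: contrapT => /forall2NP H.
have {}H e : A e -> r <= c * h e by case: (H e) => // /negP; rewrite -leNgt.
move: hr; apply/negP; rewrite -leNgt.
have [c00|cn0] := eqVneq c 0.
  by case: A0 => e /H; rewrite c00 !mul0r.
have cp : 0 < c by rewrite lt_neqAle eq_sym cn0.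
rewrite mulrC -ler_pdivrMr //; apply: lb_le_inf; first by case: A0 => e Ae; exists (h e), e.
by move=> _ [e Ae <-]; rewrite ler_pdivrMr // mulrC; exact: H.
Qed.

End lagrangian.

(** A nearby point differs from [(x, y)] by [t *: d], with [t] the norm of the difference and [d] on
    the unit sphere; the covering form of compactness merges the ranges of [t] found near each [d]
    into one. *)
Lemma strict_local_min_rays (R : realType) (n m : nat) (S : set ('rV[R]_n * 'rV[R]_m))
    (h : 'rV[R]_n * 'rV[R]_m -> R) (x : 'rV[R]_n) (y : 'rV[R]_m) :
    S (x, y) ->
    (forall d : 'rV[R]_(n + m), d != 0 -> \forall d' \near d & t \near (0 : R)^'+,
      S (x + t *: lsubmx d', y + t *: rsubmx d') ->
      h (x, y) < h (x + t *: lsubmx d', y + t *: rsubmx d')) ->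
  strict_local_min S h (x, y).
Proof.
move=> Sxy ray; split=> //.
pose U : set 'rV[R]_(n + m) := [set d | `|d| = 1].
have cU : compact U.
  apply: bounded_closed_compact.
    exists 1; split; [exact: num_real|move=> r r1 d /= ->; exact: ltW].
  have -> : U = (fun d => `|d|) @^-1` [set 1 : R] by [].
  by apply: closed_comp => [d _|]; [exact: norm_continuous|exact: closed_eq].
pose P (t : R) (d : 'rV[R]_(n + m)) := S (x + t *: lsubmx d, y + t *: rsubmx d) ->
  h (x, y) < h (x + t *: lsubmx d, y + t *: rsubmx d).
have nU : \forall t \near (0 : R)^'+, U `<=` P t.
  have /compact_near_coveringP cov := cU.
  apply: (cov R (0 : R)^'+ P) => d Ud; apply: ray.
  by apply/eqP => d0; move: Ud; rewrite /U /= d0 normr0 => /eqP; rewrite eq_sym oner_eq0.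
have [r /= r0 Hr] : exists2 r : R, 0 < r & forall t, 0 < t < r -> U `<=` P t.
  case: nU => r /= r0 H; exists r => // t /andP[t0 tr]; apply: H => //=.
  by rewrite sub0r normrN gtr0_norm.
apply/nbhs_ballP; exists r => //= -[x' y'] [/=].
rewrite -!ball_normE /= => xx' yy' Sxy' ne.
pose D := row_mx (x' - x) (y' - y).
have D0 : D != 0.
  apply/eqP => D0; apply: ne; have := congr1 lsubmx D0; have := congr1 rsubmx D0.
  by rewrite !linear0 row_mxKl row_mxKr => /eqP; rewrite subr_eq0 => /eqP -> /eqP;
     rewrite subr_eq0 => /eqP ->.
have nD : 0 < `|D| by rewrite normr_gt0.
have Dr : `|D| < r.
  have [e e0] : exists2 e, e < r & `|x - x'| <= e /\ `|y - y'| <= e.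
    exists (Num.max `|x - x'| `|y - y'|); first by rewrite gt_max xx' yy'.
    by rewrite !le_max !lexx orbT.
  by case=> xe ye; apply: le_lt_trans e0; apply: row_mx_norm_le; rewrite distrC.
have UD : U (`|D|^-1 *: D).
  by rewrite /U /= normrZ normfV normr_id mulVf // gt_eqF.
have := Hr `|D| _ _ UD; rewrite nD Dr /P => /(_ isT).
have sE : (x + `|D| *: lsubmx (`|D|^-1 *: D), y + `|D| *: rsubmx (`|D|^-1 *: D)) = (x', y').
  have -> : lsubmx (`|D|^-1 *: D) = `|D|^-1 *: (x' - x) by rewrite linearZ /= row_mxKl.
  have -> : rsubmx (`|D|^-1 *: D) = `|D|^-1 *: (y' - y) by rewrite linearZ /= row_mxKr.
  rewrite !scalerA mulfV ?gt_eqF // !scale1r.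
  by rewrite ![_ + (_ - _)]addrC !subrK.
by rewrite sE; apply.
Qed.

Section penalized_problem.
Context (R : realType) (n m p q : nat) (F f : 'rV[R]_n -> 'rV[R]_m -> R)
  (G : 'I_p -> 'rV[R]_n -> 'rV[R]_m -> R)
  (g : 'I_q -> 'rV[R]_n -> 'rV[R]_m -> R) (lambda : R)
  (xb : 'rV[R]_n) (yb zb : 'rV[R]_m) (ub : 'rV[R]_p) (vb wb : 'rV[R]_q).
Context (F_C2 : C2 (joint F)) (f_C2 : C2 (joint f))
  (G_C2 : forall i, C2 (joint (G i))) (g_C2 : forall j, C2 (joint (g j)))
  (Sol_nonempty : forall x, Sol f g x !=set0) (lambda_gt0 : 0 < lambda)
  (zeta_stationary : stationary F f G g lambda xb yb zb ub vb wb)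
  (licq : LLICQ g xb zb) (zbS : Sol f g xb zb).

(** A lower bound for the growth rate of the objective along [d], with [phi] replaced by its first
    order upper bound; also the left side of the last condition of [critical_cone] for [zb] and
    [wb]. *)
Let slope (d : 'rV[R]_(n + m)) : R := dot (gradient F xb yb) d
  + lambda * dot (gradient f xb yb) d
  - lambda * dot (grad1 (ell f g wb) xb zb) (lsubmx d).

Let near_pos (d : 'rV[R]_(n + m)) : \forall d' \near d & t \near (0 : R)^'+, 0 < t.
Proof.
have nT : \forall yv \near (d, d), setT yv by exact: filterE.
by apply: filterS (near_ray 0 nT) => -[d' t] [].
Qed.

Let wb_Lambda : Lambda f g xb zb wb.
Proof. by case: zeta_stationary => _ _ dl [_ _ cw]; split. Qed.

Let phib : phi f g xb = f xb zb.
Proof. by rewrite /phi (minvalE zbS). Qed.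

(** Any [e] in [Zset] serves, since its curvature [Q] enters at second order only. Half of [eps]
    pays for replacing [d'] by [d], the other half for the quadratic terms. *)
Lemma phi_ray1 (d : 'rV[R]_(n + m)) (eps : R) : 0 < eps ->
  \forall d' \near d & t \near (0 : R)^'+,
    phi f g (xb + t *: lsubmx d') <= phi f g xb
      + t * (dot (grad1 (ell f g wb) xb zb) (lsubmx d) + eps).
Proof.
move=> e0; have [e eZ] := Zset_nonempty (lsubmx d) licq.
set a := grad1 _ _ _; pose Q := quad (hessian (ell f g wb) xb zb) (row_mx (lsubmx d) e).
have nphi := phi_ray f_C2 g_C2 Sol_nonempty licq wb_Lambda eZ ltr01.
have nd : \forall d' \near d & t \near (0 : R)^'+, dot a (lsubmx d') <= dot a (lsubmx d) + eps / 2.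
  exists ([set d' | dot (row_mx a 0) d' <= dot a (lsubmx d) + eps / 2], setT) => /=.
    split; last exact: filterT.
    apply: (cvgr_le _ (@dot_continuous _ _ (row_mx a 0) d)).
    by rewrite -{1}[d]hsubmxK dot_row dot0l addr0 ltrDl divr_gt0.
  by move=> [d' t] [/=]; rewrite -{1}[d']hsubmxK dot_row dot0l addr0.
have nt : \forall d' \near d & t \near (0 : R)^'+, t * (`|Q| / 2 + 1) <= eps / 2.
  exists (setT, [set t | t * (`|Q| / 2 + 1) <= eps / 2]) => [/=|[d' t] [//]].
  split; first exact: filterT.
  near=> t => /=; rewrite -ler_pdivlMr; last by rewrite ltr_wpDl.
  by near: t; apply: nbhs_right_le; rewrite !divr_gt0 // ltr_wpDl.
apply: filterS (near2I (near2I (near_pos d) nphi) (near2I nd nt)).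
move=> -[d' t] /= [[t0 H] [Hd Ht]].
apply: le_trans H _; rewrite phib -/a -/Q.
have := ler_wpM2l (ltW t0) Hd; have := ler_wpM2l (ltW t0) Ht.
have : t ^+ 2 / 2 * Q <= t ^+ 2 / 2 * `|Q|.
  by rewrite ler_wpM2l ?ler_norm // divr_ge0 // sqr_ge0.
rewrite !expr2; lra.
Unshelve. all: end_near. Qed.

Lemma objective_ray_gt (d : 'rV[R]_(n + m)) : 0 < slope d ->
  \forall d' \near d & t \near (0 : R)^'+,
    objective F f g lambda (xb, yb)
      < objective F f g lambda (xb + t *: lsubmx d', yb + t *: rsubmx d').
Proof.
(* The errors [t * e] from [F] and [f] and [lambda * (t * e)] from [phi] add up to a quarter of
   [t * slope d]. *)
move=> sd; pose e := slope d / (4 * (1 + lambda)).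
have e0 : 0 < e by rewrite divr_gt0 // mulr_gt0 // addr_gt0.
have H2 := C2D F_C2 (C2Z lambda f_C2).
have dH : 'D_d (joint F + lambda *: joint f) (row_mx xb yb) =
    dot (gradient F xb yb) d + lambda * dot (gradient f xb yb) d.
  have dF := (F_C2.1 (row_mx xb yb) I).1; have df := (f_C2.1 (row_mx xb yb) I).1.
  have dF' : derivable (joint F) (row_mx xb yb) d by exact: diff_derivable.
  have df' : derivable (joint f) (row_mx xb yb) d by exact: diff_derivable.
  have dz : derivable (lambda *: joint f) (row_mx xb yb) d by exact: derivableZ.
  rewrite /gradient -!derive_dot // (deriveD dF' dz).
  by rewrite deriveZ.
apply: filterS (near2I (near_pos d) (near2I (phi_ray1 d e0) (C1_ray (row_mx xb yb) d H2.1 e0))).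
move=> -[d' t] /= [t0 [Hphi]]; rewrite dH.
have jE h : joint h (row_mx xb yb + t *: d') = h (xb + t *: lsubmx d') (yb + t *: rsubmx d').
  exact: joint_ray.
have -> : (joint F + lambda *: joint f) (row_mx xb yb + t *: d') =
    F (xb + t *: lsubmx d') (yb + t *: rsubmx d')
    + lambda * f (xb + t *: lsubmx d') (yb + t *: rsubmx d').
  by rewrite -!jE.
have -> : (joint F + lambda *: joint f) (row_mx xb yb) = F xb yb + lambda * f xb yb.
  by rewrite -!joint_row.
move=> /ler_normlP[H1 _]; rewrite /objective /=.
have := ler_wpM2l (ltW lambda_gt0) Hphi.
have te : 0 < t * e by rewrite mulr_gt0.
have : t * slope d = 4 * (t * e) + 4 * lambda * (t * e).
  by rewrite /e; field; rewrite gt_eqF // addr_gt0.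
have := mulr_gt0 lambda_gt0 te.
rewrite /slope; lra.
Qed.

Lemma slope_stationary (d : 'rV[R]_(n + m)) :
  slope d + \sum_i ub 0 i * dot (gradient (G i) xb yb) d
          + \sum_j vb 0 j * dot (gradient (g j) xb yb) d = 0.
Proof.
have [E1 E2 _ _] := zeta_stationary.
have dsum (N k : nat) (c : 'rV[R]_k) (X : 'I_k -> 'rV[R]_N) b :
    dot (\sum_i c 0 i *: X i) b = \sum_i c 0 i * dot (X i) b.
  by rewrite dot_suml; apply: eq_bigr => i _; rewrite dotZl.
have gsum (k : nat) (c : 'rV[R]_k) (h : 'I_k -> 'rV[R]_n -> 'rV[R]_m -> R) :
    \sum_i c 0 i * dot (gradient (h i) xb yb) d =
    \sum_i c 0 i * dot (grad1 (h i) xb yb) (lsubmx d)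
    + \sum_i c 0 i * dot (grad2 (h i) xb yb) (rsubmx d).
  by rewrite -big_split; apply: eq_bigr => i _; rewrite dot_gradient mulrDr.
have := congr1 (fun a => dot a (lsubmx d)) E1; have := congr1 (fun a => dot a (rsubmx d)) E2.
rewrite -scaleNr !dotDl !dsum !dotZl !dot0l !gsum /slope !dot_gradient; lra.
Qed.

(** In [slope_stationary] three nonpositive quantities add up to 0, so each vanishes, and with it
    every single product of a multiplier and a directional derivative. A positive multiplier thus
    forces the equality required on [nu]. *)
Lemma critical_coneP (d : 'rV[R]_(n + m)) : mult f g xb zb = wb ->
    (forall z, Sol f g xb z -> z = zb) -> slope d <= 0 ->
    (forall i, i \in active G xb yb -> dot (gradient (G i) xb yb) d <= 0) ->
    (forall j, j \in active g xb yb -> dot (gradient (g j) xb yb) d <= 0) ->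
  critical_cone F f G g lambda xb yb ub vb d.
Proof.
move=> mE S1 sd Gd gd.
have [_ _ _ [cu cv _]] := zeta_stationary.
have le0 (k : nat) (c : 'rV[R]_k) (h : 'I_k -> 'rV[R]_n -> 'rV[R]_m -> R) :
    complementary c (fun i => h i xb yb) ->
    (forall i, i \in active h xb yb -> dot (gradient (h i) xb yb) d <= 0) ->
    forall i, c 0 i * dot (gradient (h i) xb yb) d <= 0.
  move=> cc hd i; have [c0 _ _] := cc.
  have /eqP := complementary_eq0 cc i; rewrite mulf_eq0 => /orP[/eqP ->|hi].
    by rewrite mul0r.
  by rewrite mulr_ge0_le0 //; apply: hd; rewrite inE.
have Gle := le0 _ _ _ cu Gd; have gle := le0 _ _ _ cv gd.
have sG : \sum_i ub 0 i * dot (gradient (G i) xb yb) d <= 0 by apply: sumr_le0.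
have sg : \sum_i vb 0 i * dot (gradient (g i) xb yb) d <= 0 by apply: sumr_le0.
have st := slope_stationary d.
have eq0 (k : nat) (c : 'rV[R]_k) (h : 'I_k -> 'rV[R]_n -> 'rV[R]_m -> R) :
    (forall i, c 0 i * dot (gradient (h i) xb yb) d <= 0) ->
    \sum_i c 0 i * dot (gradient (h i) xb yb) d = 0 ->
    forall i, i \in nu h xb yb c -> dot (gradient (h i) xb yb) d = 0.
  move=> hle s0 i; rewrite inE => /andP[_ ci].
  have /psumr_eq0P H : forall i : 'I_k, true -> 0 <= - (c 0 i * dot (gradient (h i) xb yb) d).
    by move=> j _; rewrite oppr_ge0.
  have := H; rewrite sumrN s0 oppr0 => /(_ erefl i isT)/eqP.
  by rewrite oppr_eq0 mulf_eq0 gt_eqF //= => /eqP.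
have th (k : nat) (c : 'rV[R]_k) (h : 'I_k -> 'rV[R]_n -> 'rV[R]_m -> R) i :
    i \in theta h xb yb c -> i \in active h xb yb.
  by rewrite inE => /andP[].
split.
- by apply: (eq0 _ _ _ Gle); lra.
- by move=> i /th; exact: Gd.
- by apply: (eq0 _ _ _ gle); lra.
- by move=> i /th; exact: gd.
- by move=> z /S1 ->; rewrite mE.
Qed.

(** If a feasible point [(x, y)] had objective at most that of [(xb, yb)], nonnegative multipliers
    would bound [L x y] by [L xb yb] plus [lambda * kappa0] times the increment of [phi]. After the
    first order terms cancel, the second order ones contradict [lambda * kappa0 * Q < M].
    Inequalities are multiplied by [kappa0], never divided, since it may be 0. *)
Lemma objective_ray_second_order (d : 'rV[R]_(n + m)) : mult f g xb zb = wb ->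
    (forall z, Sol f g xb z -> z = zb) ->
    second_order_condition F f G g lambda xb yb d ->
  \forall d' \near d & t \near (0 : R)^'+,
    feasible G g (xb + t *: lsubmx d', yb + t *: rsubmx d') ->
    objective F f g lambda (xb, yb)
      < objective F f g lambda (xb + t *: lsubmx d', yb + t *: rsubmx d').
Proof.
move=> mE S1 [k [zt [wt [kappa [u [v]]]]]].
set AG := active_dir G xb yb d; set Ag := active_dir g xb yb d; set kappa0 := \sum_t _.
case=> zwt [grad1_eq [grad2_eq [_ [kappa0_ge0 [u0 [v0 so]]]]]].
have ztE t : zt t = zb by have [[/S1 ->]] := zwt t.
have wtE t : wt t = wb by have [_ /multE] := zwt t; rewrite ztE mE.
set L := Lbar _ _ _ _ _ _ _ _ _ _ in grad1_eq grad2_eq so.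
have {}so : lambda * kappa0 * minval (Zset g (lsubmx d) xb zb)
    (fun e => quad (hessian (ell f g wb) xb zb) (row_mx (lsubmx d) e)) < quad (hessian L xb yb) d.
  apply: le_lt_trans so; rewrite -mulrA ler_pM2l // mulr_suml.
  by apply: ler_sum => t _; rewrite /xi ztE mE.
have [|e eZ {so}] := minval_gt _ (Zset_nonempty _ licq) so; first by rewrite mulr_ge0 // ltW.
pose Q := quad (hessian (ell f g wb) xb zb) (row_mx (lsubmx d) e).
pose M := quad (hessian L xb yb) d.
move=> QM; have {}QM : lambda * kappa0 * Q < M := QM.
(* The errors [t ^+ 2 * eps] and [lambda * kappa0 * (t ^+ 2 * eps)] add up to half of the gap
   [t ^+ 2 / 2 * (M - lambda * kappa0 * Q)]. *)
pose eps := (M - lambda * kappa0 * Q) / (4 * (1 + lambda * kappa0)).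
have lk0 : 0 <= lambda * kappa0 by rewrite mulr_ge0 // ltW.
have eps0 : 0 < eps by rewrite divr_gt0 ?subr_gt0 // mulr_gt0 // ltr_pwDl.
have nphi := phi_ray f_C2 g_C2 Sol_nonempty licq wb_Lambda eZ eps0.
have L2 : C2 (joint L) by exact: C2_Lbar.
have nL := C2_ray (row_mx xb yb) d L2 eps0.
apply: filterS (near2I (near_pos d) (near2I nphi nL)) => -[d' t] /= [t0 [Hphi HL]] [Gs gs].
move: HL; rewrite joint_ray joint_row -/M => /ler_normlP[HL _].
set x := xb + _ in Hphi HL Gs gs *; set y := yb + _ in HL Gs gs *.
rewrite /= in Gs gs; rewrite /objective /= ltNge; apply/negP => Hobj.
(* [lambda * kappa0] times the first order term of the bound on [phi], at the same [d']: this is the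
   exact cancellation. *)
have dL : 'D_d' (joint L) (row_mx xb yb) =
    lambda * kappa0 * dot (grad1 (ell f g wb) xb zb) (lsubmx d').
  have [l1 _] := L2; rewrite derive_dot; last by have [] := l1 (row_mx xb yb) I.
  rewrite grad_joint -{1}[d']hsubmxK dot_row grad2_eq dot0l addr0.
  move/eqP: grad1_eq; rewrite subr_eq0 => /eqP ->.
  rewrite (eq_bigr (fun t => kappa t *: grad1 (ell f g wb) xb zb)); last first.
    by move=> i _; rewrite wtE ztE.
  by rewrite -scaler_suml scalerA dotZl.
have Lb : L xb yb = kappa0 * (F xb yb + lambda * f xb yb).
  rewrite /L /Lbar !big1 ?addr0 // => i; rewrite !inE => /andP[/eqP -> _]; exact: mulr0.
have Ls : L x y <= kappa0 * (F x y + lambda * f x y).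
  have sG : \sum_(i in AG) u 0 i * G i x y <= 0.
    by apply: sumr_le0 => i iA; rewrite mulr_ge0_le0 // u0.
  have sg : \sum_(j in Ag) v 0 j * g j x y <= 0.
    by apply: sumr_le0 => j jA; rewrite mulr_ge0_le0 // v0.
  by rewrite /L /Lbar; lra.
have k0H : kappa0 * (F x y + lambda * f x y) <= kappa0 * (F xb yb + lambda * f xb yb)
    + lambda * kappa0 * (phi f g x - phi f g xb).
  have := ler_wpM2l kappa0_ge0 Hobj; lra.
have := ler_wpM2l lk0 Hphi; rewrite phib in k0H.
rewrite -/Q dL in HL * => Hphi'.
have te : 0 < t ^+ 2 * eps by rewrite mulr_gt0 // exprn_gt0.
have epsE : t ^+ 2 * (M - lambda * kappa0 * Q) =
    4 * (t ^+ 2 * eps) + 4 * (lambda * kappa0 * (t ^+ 2 * eps)).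
  by rewrite /eps; field; rewrite gt_eqF // ltr_pwDl.
have : 0 <= lambda * kappa0 * (t ^+ 2 * eps) by rewrite mulr_ge0 // ltW.
rewrite Lb in HL; lra.
Qed.
End penalized_problem.

Theorem theorem6p1 (R : realType) (n m p q : nat)
  (F f : 'rV[R]_n -> 'rV[R]_m -> R)
  (G : 'I_p -> 'rV[R]_n -> 'rV[R]_m -> R)
  (g : 'I_q -> 'rV[R]_n -> 'rV[R]_m -> R)
  (F_C2 : C2 (joint F)) (f_C2 : C2 (joint f))
  (G_C2 : forall i, C2 (joint (G i))) (g_C2 : forall j, C2 (joint (g j)))
  (Sol_nonempty : forall x, Sol f g x !=set0)
  (lambda : R) (lambda_gt0 : 0 < lambda)
  (xb : 'rV[R]_n) (yb zb : 'rV[R]_m) (ub : 'rV[R]_p) (vb wb : 'rV[R]_q)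
  (zeta_stationary : stationary F f G g lambda xb yb zb ub vb wb)
  (f_convex : convex_function setT (f xb))
  (g_convex : forall j, convex_function setT (g j xb))
  (K_compact : uniformly_compact g xb) (K_nonempty : K g xb !=set0)
  (licq : forall z, Sol f g xb z -> LLICQ g xb z)
  (lower_conditions : forall d,
     critical_cone F f G g lambda xb yb ub vb d ->
     [/\ forall z, S1 f g xb (lsubmx d) z -> LSCC g xb z (mult f g xb z),
         LSMP f g xb (lsubmx d) & LSOSC f g xb (lsubmx d)])
  (second_order : forall d,
     critical_cone F f G g lambda xb yb ub vb d -> d != 0 ->
     second_order_condition F f G g lambda xb yb d) :
  strict_local_min (feasible G g) (objective F f g lambda) (xb, yb).
Proof.
have [_ _ dl [[_ Gyb _] [_ gyb _] cw]] := zeta_stationary.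
have wbL : Lambda f g xb zb wb by split.
have zbS : Sol f g xb zb := Lambda_Sol f_C2 g_C2 f_convex g_convex wbL.
have mE : mult f g xb zb = wb.
  have multL : Lambda f g xb zb (mult f g xb zb) by apply: xgetPex; exists wb.
  exact: Lambda_unique f_C2 g_C2 (licq _ zbS) multL wbL.
have cone0 : critical_cone F f G g lambda xb yb ub vb 0.
  by split=> *; rewrite ?linear0 !dot0r ?mulr0 ?subr0 ?addr0.
have [_ lsmp _] := lower_conditions _ cone0.
have S1E z : Sol f g xb z -> S1 f g xb (lsubmx (0 : 'rV[R]_(n + m))) z.
  by move=> Sz; split=> // z' _; rewrite linear0 !dot0r.
have zb_unique z : Sol f g xb z -> z = zb.
  move=> Sz; apply: submanifold_convex_compact Sz zbS.
  - exact: Sol_compact f_C2 g_C2 K_compact (Sol_nonempty xb).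
  - exact: Sol_segment f_convex g_convex.
  - by move=> z0 /S1E/lsmp[V [nV sV _]]; exists V.
apply: strict_local_min_rays => [|d d0]; first by split.
(* Each direction falls into one of three cases: an active constraint grows and nearby rays are
   infeasible; the objective grows to first order; or the direction is critical and the second order
   condition applies. *)
have [[i iA Gd]|/forall2NP Gd] :=
    pselect (exists2 i, i \in active G xb yb & 0 < dot (gradient (G i) xb yb) d).
  have G0 : G i xb yb = 0 by move: iA; rewrite inE => /eqP.
  apply: filterS (active_ray_gt0 (G_C2 i) G0 Gd) => -[d' t] /= + [/(_ i) + _].
  by move=> /lt_le_trans/[apply]; rewrite ltxx.
have [[j jA gd]|/forall2NP gd] :=
    pselect (exists2 j, j \in active g xb yb & 0 < dot (gradient (g j) xb yb) d).
  have g0 : g j xb yb = 0 by move: jA; rewrite inE => /eqP.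
  apply: filterS (active_ray_gt0 (g_C2 j) g0 gd) => -[d' t] /= + [_ /(_ j)].
  by move=> /lt_le_trans/[apply]; rewrite ltxx.
pose slope := dot (gradient F xb yb) d + lambda * dot (gradient f xb yb) d
  - lambda * dot (grad1 (ell f g wb) xb zb) (lsubmx d).
have [sd|sd] := ltP 0 slope.
  have H := objective_ray_gt F_C2 f_C2 g_C2 Sol_nonempty lambda_gt0 zeta_stationary
    (licq _ zbS) zbS sd.
  by apply: filterS H => -[d' t].
have dC : critical_cone F f G g lambda xb yb ub vb d.
  apply: (critical_coneP zeta_stationary mE zb_unique sd) => k kA; rewrite leNgt; apply/negP.
    by case: (Gd k).
  by case: (gd k).
have H := objective_ray_second_order F_C2 f_C2 G_C2 g_C2 Sol_nonempty lambda_gt0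
  zeta_stationary (licq _ zbS) zbS mE zb_unique (second_order _ dC d0).
exact: H.
Qed.
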